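(* For every partition $\lambda$ with at most $n$ parts, $$u_{\lambda,(1^n)}(q)=q^{\frac{n-|\lambda|}{2}}\,X_{\lambda,(1^n)}(q).$$
   Context: Fix $n\ge1$, $(1^n)=(1,\dots,1)$, $\rho_n=(n,\dots,1)$, $|\beta|=\sum\beta_i$, $x^\beta=\prod x_i^{\beta_i}$; $S_n$ permutes coordinates, $l(\sigma)$ = number of inversions. $f_q(\beta)$ is the coefficient of $x^\beta$ in $\prod_{1\le i<j\le n}(1-qx_i/x_j)^{-1}\prod_{1\le r<s\le n}(1-\frac{q}{x_rx_s})^{-1}$, and $u_{\lambda,\mu}(q)=\sum_{\sigma\in S_n}(-1)^{l(\sigma)}f_q(\sigma(\lambda+\rho_n)-\mu-\rho_n)$. One dimension sum for $\mu=(1^n)$: let $\mathcal{C}_n$ be the ordered alphabet $1<2<\cdots<n<\bar n<\cdots<\bar1$, with weights $\mathrm{wt}(k)=\varepsilon_k$, $\mathrm{wt}(\bar k)=-\varepsilon_k$ ($\varepsilon_k$ the standard basis of $\mathbb{Z}^n$). Let $E_\lambda$ be the set of words $b=x_1\otimes\cdots\otimes x_n$, $x_i\in\mathcal{C}_n$, such that for every $i=1,\dots,n$ the vector $w_i=\sum_{j\le i}\mathrm{wt}(x_j)$ is a partition (weakly decreasing with nonnegative entries) and $w_n=\lambda$; these are exactly the highest weight vertices of weight $\lambda$ in the $U_q(\mathfrak{sp}_{2n})$-crystal $B(\Lambda_1)^{\otimes n}$ (Kashiwara's tensor convention). For letters $x,y$ set $H(x\otimes y)=1$ if $x\ge y$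 and $0$ if $x<y$. Then $X_{\lambda,(1^n)}(q)=\sum_{b\in E_\lambda}q^{H(b)}$ with $H(b)=\sum_{i=1}^{n-1}(n-i)H(x_i\otimes x_{i+1})$ (this is the one dimension sum of Hatayama–Kuniba–Okado–Takagi for $C_n^{(1)}$ specialized to $\mu=(1^n)$). *)

(* Defs.v *)
From mathcomp Require Import all_boot all_order all_algebra all_fingroup.
Set Implicit Arguments. Unset Strict Implicit. Unset Printing Implicit Defensive.
Import GRing.Theory Num.Theory.
Local Open Scope ring_scope.

(* Coordinates are indexed by 'I_n (0-based): coordinate i <-> paper's i+1. *)

Definition rho (n : nat) (i : 'I_n) : int := (n - i)%N%:Z.

Definition posp (n : nat) := {p : 'I_n * 'I_n | (p.1 < p.2)%N}.

(* weight (exponent vector of x) of the monomial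
   prod_{i<j} (q x_i/x_j)^{k_ij} * prod_{r<s} (q/(x_r x_s))^{m_rs} *)
Definition mon_wt (n d : nat) (k m : {ffun posp n -> 'I_d.+1}) (t : 'I_n) : int :=
  \sum_(p : posp n)
     ((k p : nat)%:Z * ((t == (val p).1)%:Z - (t == (val p).2)%:Z)
      - (m p : nat)%:Z * ((t == (val p).1)%:Z + (t == (val p).2)%:Z)).

(* coefficient of q^d x^beta in
   prod_{i<j} (1 - q x_i/x_j)^{-1} prod_{r<s} (1 - q/(x_r x_s))^{-1}
   (expanding each factor as a geometric series; all exponents are <= d) *)
Definition fcoef (n : nat) (beta : 'I_n -> int) (d : nat) : nat :=
  #|[set km : {ffun posp n -> 'I_d.+1} * {ffun posp n -> 'I_d.+1} |
      ((\sum_(p : posp n) ((km.1 p : nat) + (km.2 p : nat)))%N == d)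
      && [forall t, mon_wt km.1 km.2 t == beta t]]|.

Definition inversions (n : nat) (s : 'S_n) : nat :=
  #|[set p : 'I_n * 'I_n | (p.1 < p.2)%N && (s p.2 < s p.1)%N]|.

(* coefficient of q^d in u_{lambda,mu}(q); sigma acts on coordinates by
   (sigma v)_i = v_{sigma^{-1} i} *)
Definition ucoef (n : nat) (lam mu : 'I_n -> nat) (d : nat) : int :=
  \sum_(s : 'S_n) (-1) ^+ inversions s *
     (fcoef (fun i : 'I_n => (lam ((s^-1)%g i))%:Z + rho ((s^-1)%g i) - (mu i)%:Z - rho i) d)%:Z.

(* The alphabet C_n : 1 < ... < n < nbar < ... < 1bar, encoded by 'I_(n+n):
   index a < n is the letter a+1, index a >= n is the letter kbar with a = 2n-k. *)
Definition letter_wt (n : nat) (a : 'I_(n + n)) (t : 'I_n) : int :=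
  if (a < n)%N then (t == a :> nat)%:Z
  else - ((t == ((n + n).-1 - a)%N :> nat)%:Z).

Definition partial_wt (n : nat) (b : {ffun 'I_n -> 'I_(n + n)}) (i : 'I_n) (t : 'I_n) : int :=
  \sum_(j : 'I_n | (j <= i)%N) letter_wt (b j) t.

Definition is_partition_vec (n : nat) (v : 'I_n -> int) : bool :=
  [forall i, 0 <= v i] && [forall i : 'I_n, forall j : 'I_n, ((i <= j)%N ==> (v j <= v i))].

Definition in_E (n : nat) (lam : 'I_n -> nat) (b : {ffun 'I_n -> 'I_(n + n)}) : bool :=
  [forall i, is_partition_vec (partial_wt b i)]
  && [forall t, (\sum_(j : 'I_n) letter_wt (b j) t) == (lam t)%:Z].

Definition energy (n : nat) (b : {ffun 'I_n -> 'I_(n + n)}) : nat :=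
  let s := [seq (b i : nat) | i <- enum 'I_n] in
  (\sum_(0 <= p < n.-1) (n - p.+1) * (nth 0 s p.+1 <= nth 0 s p))%N.

Definition Xpoly (n : nat) (lam : 'I_n -> nat) : {poly int} :=
  \sum_(b : {ffun 'I_n -> 'I_(n + n)} | in_E lam b) 'X^(energy b).

(* Main.v *)
From HB Require Import structures.
Require Import Defs.
From mathcomp Require Import all_boot all_order all_algebra all_fingroup.
From mathcomp Require Import boolp ring zify.
From mathcomp Require Import qpoly mpoly.
Set Implicit Arguments. Unset Strict Implicit. Unset Printing Implicit Defensive.
Import Order.TTheory GRing.Theory Num.Theory.
Local Open Scope ring_scope.

(** Let [h] be a power series with constant term 1 and, for every integer vector [a],
    let [s_a(h) = det (h_(a_i - i + j))]. Both sides are shown to generate the same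
    symmetric function: with [(q)_n = (1-q)...(1-q^n)], the sum of [f_q(a - 1^n) s_a(h)]
    over [a] and the sum of [q^(energy + number of barred letters) s_(wt b)(h)] over
    highest weight words [b] are both equal to [(q)_n [z^n] Z(z)], where [Z] is the
    solution with [Z(0) = 1] of
      [prod_(k >= 1) (1 - q^k z^2) . h(-z) . Z(z) = Z(qz)].
    For the first sum, peel off [x_1]: this applies Bernstein's operator
    [[w^1] H(w) E*(-1/w) H*(q/w) H*(qw)], and all the adjoint operators [E*], [H*] act on
    [Z] by explicit scalar factors. For the second, expand the energy over the runs of
    strictly increasing letters: a run of length [k] adds a vertical strip, then removes
    one, so it is the coefficient of [z^k] in [E*(qz) E(z)].
    The energy is thus matched up to [q^(number of bars)], and a highest weight word of
    weight [lambda] has [(n - |lambda|)/2] bars. Specialising [h] to the complete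
    symmetric functions of [x_1, ..., x_n] and multiplying by the Vandermonde
    determinant, the coefficient of [x^(lambda + rho)] isolates [lambda].

    To read off the coefficient of [q^d], one works modulo [q^(d+1)]: then [q] is
    nilpotent and every sum and product is finite. *)

(** * Formal power series *)

Record fps (R : Type) := Fps { coef : nat -> R }.
Notation "f .[: n ]" := (coef f n) (at level 2, left associativity, format "f .[: n ]").

(** Equality of coefficient functions is not decidable; the structures that a ring requires come
    from classical logic. *)
HB.instance Definition _ (R : Type) := gen_eqMixin (fps R).
HB.instance Definition _ (R : Type) := gen_choiceMixin (fps R).

Lemma fpsP (R : Type) (f g : fps R) : (forall n, f.[:n] = g.[:n]) -> f = g.
Proof. by case: f g => [f] [g] /= fg; congr Fps; apply: funext. Qed.

Lemma mul_geom (R : pzRingType) (u : R) n :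
  (1 - u) * \sum_(i < n) u ^+ i = 1 - u ^+ n.
Proof. by rewrite -[RHS]opprB subrX1 -mulNr opprB. Qed.

Section FpsRing.
Variable R : comNzRingType.
Implicit Types f g h : fps R.

Definition fps_add f g := Fps (fun n => f.[:n] + g.[:n]).
Definition fps_opp f := Fps (fun n => - f.[:n]).
Definition fps_const (c : R) := Fps (fun n => if n is 0%N then c else 0).
Definition fps_mul f g := Fps (fun n => \sum_(i < n.+1) f.[:i] * g.[:n - i]).

Fact fps_addA : associative fps_add.
Proof. by move=> f g h; apply: fpsP => n /=; rewrite addrA. Qed.
Fact fps_addC : commutative fps_add.
Proof. by move=> f g; apply: fpsP => n /=; rewrite addrC. Qed.
Fact fps_add0 : left_id (fps_const 0) fps_add.
Proof. by move=> f; apply: fpsP => -[|n] /=; rewrite add0r. Qed.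
Fact fps_addN : left_inverse (fps_const 0) fps_opp fps_add.
Proof. by move=> f; apply: fpsP => -[|n] /=; rewrite addNr. Qed.

HB.instance Definition _ :=
  GRing.isZmodule.Build (fps R) fps_addA fps_addC fps_add0 fps_addN.

Definition fps_trunc N f : {poly R} := \poly_(i < N) f.[:i].

Lemma coef_trunc N f i : (fps_trunc N f)`_i = if (i < N)%N then f.[:i] else 0.
Proof. exact: coef_poly. Qed.

(** A coefficient of a product sees only terms of at most its own degree, so commutativity and
    associativity are inherited from polynomials. *)
Lemma coef_mul_trunc N f g n : (n < N)%N ->
  (fps_mul f g).[:n] = (fps_trunc N f * fps_trunc N g)`_n.
Proof.
move=> nN; rewrite coefM /=; apply: eq_bigr => i _.
by rewrite !coef_trunc (leq_ltn_trans (leq_subr _ _) nN) (leq_ltn_trans (leq_ord i) nN).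
Qed.

Fact fps_mulC : commutative fps_mul.
Proof.
by move=> f g; apply: fpsP => n; rewrite !(@coef_mul_trunc n.+1) // mulrC.
Qed.

Fact fps_mulA : associative fps_mul.
Proof.
move=> f g h; apply: fpsP => n.
pose N := n.+1; pose t := fps_trunc N.
have El i j k m : (m < N)%N ->
    \sum_(l < m.+1) (fps_mul i j).[:l] * k.[:m - l] = (t i * t j * t k)`_m.
  move=> mN; rewrite coefM; apply: eq_bigr => l _.
  rewrite coef_trunc (leq_ltn_trans (leq_subr _ _) mN).
  by rewrite (@coef_mul_trunc N) // (leq_ltn_trans (leq_ord l)).
rewrite [fps_mul f _]fps_mulC; rewrite /= !El //.
by rewrite [t g * t h * _]mulrC mulrA.
Qed.

Fact fps_mul1 : left_id (fps_const 1) fps_mul.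
Proof.
move=> f; apply: fpsP => n /=; rewrite big_ord_recl /= subn0 mul1r big1 ?addr0 //.
by move=> i _; rewrite mul0r.
Qed.

Fact fps_mulDl : left_distributive fps_mul fps_add.
Proof.
move=> f g h; apply: fpsP => n /=; rewrite -big_split; apply: eq_bigr => i _ /=.
by rewrite mulrDl.
Qed.

Fact fps_one_neq0 : fps_const 1 != fps_const 0.
Proof. by apply/eqP => -[/(congr1 (@^~ 0%N))] /eqP; rewrite oner_eq0. Qed.

HB.instance Definition _ := GRing.Zmodule_isComNzRing.Build (fps R)
  fps_mulA fps_mulC fps_mul1 fps_mulDl fps_one_neq0.

Lemma fps_coefD f g n : (f + g).[:n] = f.[:n] + g.[:n]. Proof. by []. Qed.
Lemma fps_coefB f g n : (f - g).[:n] = f.[:n] - g.[:n]. Proof. by []. Qed.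
Lemma fps_coef0 n : (0 : fps R).[:n] = 0. Proof. by case: n. Qed.
Lemma fps_coef1 n : (1 : fps R).[:n] = (n == 0)%N%:R. Proof. by case: n. Qed.
Lemma fps_coefM f g n : (f * g).[:n] = \sum_(i < n.+1) f.[:i] * g.[:n - i].
Proof. by []. Qed.
Lemma fps_coefM0 f g : (f * g).[:0] = f.[:0] * g.[:0].
Proof. by rewrite fps_coefM big_ord1. Qed.

Lemma fps_coef_sum I (r : seq I) (P : pred I) (F : I -> fps R) n :
  (\sum_(i <- r | P i) F i).[:n] = \sum_(i <- r | P i) (F i).[:n].
Proof.
by elim/big_rec2: _ => [|i y z _ <-]; rewrite ?fps_coef0.
Qed.

(** Packaged as a ring morphism so that it passes through products and determinants. *)
Definition ctcoef f := f.[:0].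
Fact ctcoef_zmod : zmod_morphism ctcoef. Proof. by []. Qed.
Fact ctcoef_monoid : monoid_morphism ctcoef.
Proof. by split=> // f g; exact: fps_coefM0. Qed.
HB.instance Definition _ := GRing.isZmodMorphism.Build _ _ ctcoef ctcoef_zmod.
HB.instance Definition _ := GRing.isMonoidMorphism.Build _ _ ctcoef ctcoef_monoid.

Fact fps_const_zmod : zmod_morphism fps_const.
Proof. by move=> a b; apply: fpsP => -[|n] //=; rewrite subr0. Qed.
Lemma fps_coefCM c f n : (fps_const c * f).[:n] = c * f.[:n].
Proof.
rewrite fps_coefM big_ord_recl /= subn0 big1 ?addr0 // => i _; rewrite mul0r //.
Qed.
Fact fps_const_monoid : monoid_morphism fps_const.
Proof.
by split=> // a b; apply: fpsP => n; rewrite fps_coefCM; case: n => [|n] //=; rewrite mulr0.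
Qed.
HB.instance Definition _ := GRing.isZmodMorphism.Build _ _ fps_const fps_const_zmod.
HB.instance Definition _ := GRing.isMonoidMorphism.Build _ _ fps_const fps_const_monoid.

Definition fps_var : fps R := Fps (fun n => (n == 1)%N%:R).

Lemma fps_coefXM f n : (fps_var * f).[:n] = if n is m.+1 then f.[:m] else 0.
Proof.
rewrite fps_coefM; case: n => [|n]; first by rewrite big_ord1 /= mul0r.
rewrite big_ord_recl /= mul0r add0r big_ord_recl /= mul1r subSS subn0.
by rewrite big1 ?addr0 // => i _; rewrite mul0r.
Qed.

Lemma fps_coefXnM k f n : (fps_var ^+ k * f).[:n] = if (k <= n)%N then f.[:n - k] else 0.
Proof.
elim: k n => [|k IH] n; first by rewrite expr0 mul1r subn0.
rewrite exprS -mulrA fps_coefXM; case: n => [|n] //; rewrite IH; by case: ifP.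
Qed.

Definition fps_scale (c : R) f := Fps (fun n => c ^+ n * f.[:n]).
Lemma fps_coef_scale c f n : (fps_scale c f).[:n] = c ^+ n * f.[:n]. Proof. by []. Qed.
Fact fps_scale_zmod c : zmod_morphism (fps_scale c).
Proof. by move=> f g; apply: fpsP => n /=; rewrite mulrBr. Qed.
Fact fps_scale_monoid c : monoid_morphism (fps_scale c).
Proof.
split=> [|f g]; apply: fpsP => n.
  by case: n => [|n] /=; rewrite ?mul1r ?mulr0.
rewrite [LHS]big_distrr; apply: eq_bigr => i _ /=.
rewrite -{1}(subnKC (leq_ord i)) exprD; ring.
Qed.
HB.instance Definition _ c := GRing.isZmodMorphism.Build _ _ (fps_scale c) (fps_scale_zmod c).
HB.instance Definition _ c := GRing.isMonoidMorphism.Build _ _ (fps_scale c) (fps_scale_monoid c).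

Lemma fps_scaleA a b f : fps_scale a (fps_scale b f) = fps_scale (a * b) f.
Proof. by apply: fpsP => n /=; rewrite exprMn mulrA. Qed.
Lemma fps_scale1 f : fps_scale 1 f = f.
Proof. by apply: fpsP => n /=; rewrite expr1n mul1r. Qed.
Lemma fps_scale0 f : fps_scale 0 f = fps_const f.[:0].
Proof. by apply: fpsP => -[|n] /=; rewrite ?expr0 ?mul1r // expr0n mul0r. Qed.
Lemma fps_scaleC a c : fps_scale a (fps_const c) = fps_const c.
Proof. by apply: fpsP => -[|n] /=; rewrite ?mul1r ?mulr0. Qed.
Lemma fps_scaleX a : fps_scale a fps_var = fps_const a * fps_var.
Proof.
by apply: fpsP => n; rewrite fps_coefCM; case: n => [|[|n]] /=; rewrite ?mulr0 ?expr1.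
Qed.

Lemma coef_expr_small u k n : u.[:0] = 0 -> (n < k)%N -> (u ^+ k).[:n] = 0.
Proof.
move=> u0; elim: k n => [|k IH] n //; rewrite exprS fps_coefM => nk.
rewrite big1 // => -[[|i] /= ilt] _; first by rewrite u0 mul0r.
by rewrite IH ?mulr0 //; lia.
Qed.

(* Neumann series, truncated at [n] in degree [n] so that it is a finite sum. *)
Definition fps_inv f := Fps (fun n => (\sum_(k < n.+1) (1 - f) ^+ k).[:n]).

Lemma fps_mulVr f : f.[:0] = 1 -> f * fps_inv f = 1.
Proof.
move=> f0; set u := 1 - f.
have u0 : u.[:0] = 0 by rewrite fps_coefB f0 subrr.
have E N n : (n <= N)%N -> (fps_inv f).[:n] = (\sum_(k < N.+1) u ^+ k).[:n].
  move=> nN /=; rewrite !fps_coef_sum (big_ord_widen N.+1 (fun k => (u ^+ k).[:n])) //.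
  rewrite [RHS](bigID (fun i : 'I__ => (i < n.+1)%N)) /= [X in _ + X]big1 ?addr0 //.
  by move=> i; rewrite -leqNgt => /(coef_expr_small u0).
apply: fpsP => n.
have -> : (f * fps_inv f).[:n] = (f * \sum_(k < n.+1) u ^+ k).[:n].
  rewrite !fps_coefM; apply: eq_bigr => i _; congr (_ * _).
  by apply: E; rewrite leq_subr.
have -> : f = 1 - u by rewrite /u; ring.
have -> : (1 - u) * \sum_(i < n.+1) u ^+ i = 1 - u ^+ n.+1.
  exact: mul_geom.
by rewrite fps_coefB coef_expr_small // subr0.
Qed.

Lemma fps_inv1 : fps_inv 1 = 1.
Proof. by rewrite -[LHS]mul1r fps_mulVr. Qed.

Lemma fps_inv0 f : (fps_inv f).[:0] = 1.
Proof. by rewrite /= fps_coef_sum big_ord1 expr0. Qed.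
End FpsRing.

Section FpsMap.
Variables (R S : comNzRingType) (phi : {rmorphism R -> S}).
Definition fps_map (f : fps R) := Fps (fun n => phi f.[:n]).
Fact fps_map_zmod : zmod_morphism fps_map.
Proof. by move=> f g; apply: fpsP => n /=; rewrite rmorphB. Qed.
Fact fps_map_monoid : monoid_morphism fps_map.
Proof.
split=> [|f g]; apply: fpsP => n /=; first by case: n => [|n] /=; rewrite ?rmorph1 ?rmorph0.
by rewrite rmorph_sum; apply: eq_bigr => i _; rewrite rmorphM.
Qed.
HB.instance Definition _ := GRing.isZmodMorphism.Build _ _ fps_map fps_map_zmod.
HB.instance Definition _ := GRing.isMonoidMorphism.Build _ _ fps_map fps_map_monoid.
Lemma fps_mapC c : fps_map (fps_const c) = fps_const (phi c).
Proof. by apply: fpsP => -[|n] //=; rewrite rmorph0. Qed.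
Lemma fps_mapX : fps_map (fps_var R) = fps_var S.
Proof. by apply: fpsP => n /=; rewrite rmorph_nat. Qed.
Lemma fps_map_scale c f : fps_map (fps_scale c f) = fps_scale (phi c) (fps_map f).
Proof. by apply: fpsP => n /=; rewrite rmorphM rmorphXn. Qed.
End FpsMap.

Section FpsDiag.
Variable R : comNzRingType.
Implicit Types F G : fps (fps R).
(** Sets two variables equal: F(y, z) becomes F(z, z). *)
Definition fps_diag F : fps R := Fps (fun n => \sum_(i < n.+1) F.[:i].[:n - i]).

Fact fps_diag_zmod : zmod_morphism fps_diag.
Proof. by move=> F G; apply: fpsP => n /=; rewrite -sumrB. Qed.
HB.instance Definition _ := GRing.isZmodMorphism.Build _ _ fps_diag fps_diag_zmod.

Lemma fps_diagD F G : fps_diag (F + G) = fps_diag F + fps_diag G.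
Proof. exact: raddfD. Qed.

Lemma fps_diagC f : fps_diag (fps_const f) = f.
Proof.
apply: fpsP => n /=; rewrite big_ord_recl /= subn0 big1 ?addr0 // => i _.
exact: fps_coef0.
Qed.

Lemma fps_diagXM F : fps_diag (fps_var _ * F) = fps_var _ * fps_diag F.
Proof.
apply: fpsP => n; rewrite fps_coefXM; case: n => [|n].
  by rewrite [LHS]big_ord1 fps_coefXM fps_coef0.
rewrite [LHS]big_ord_recl fps_coefXM fps_coef0 add0r; apply: eq_bigr => i _.
by rewrite fps_coefXM.
Qed.

Lemma fps_decomp (A : comNzRingType) (f : fps A) :
  f = fps_const f.[:0] + fps_var _ * Fps (fun n => f.[:n.+1]).
Proof. by apply: fpsP => n; rewrite fps_coefD fps_coefXM; case: n => [|n] /=; ring. Qed.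

Lemma fps_diagCM f F : fps_diag (fps_const f * F) = f * fps_diag F.
Proof.
apply: fpsP => n; elim: n F => [|n IH] F.
all: rewrite [F]fps_decomp mulrDr -rmorphM mulrCA !fps_diagD !fps_diagC.
all: rewrite !fps_diagXM mulrDr [f * (_ * _)]mulrCA !fps_coefD !fps_coefXM //.
by rewrite IH.
Qed.

Fact fps_diag_monoid : monoid_morphism fps_diag.
Proof.
split=> [|F G]; first exact: fps_diagC.
apply: fpsP => n; elim: n F G => [|n IH] F G.
all: rewrite {1}[F]fps_decomp [X in _ = coef (fps_diag X * _) _]fps_decomp.
all: rewrite mulrDl -mulrA !fps_diagD fps_diagCM fps_diagC !fps_diagXM.
all: rewrite mulrDl -mulrA !fps_coefD !fps_coefXM //.
by rewrite IH.
Qed.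
HB.instance Definition _ := GRing.isMonoidMorphism.Build _ _ fps_diag fps_diag_monoid.
End FpsDiag.

(** * Jacobi-Trudi determinants *)

Lemma ltn_ordS n (i : 'I_n) : (i < n.+1)%N.
Proof. by rewrite ltnS ltnW. Qed.

Section BidiagonalMinors.
Variables (R : comNzRingType) (n : nat) (G : 'I_n -> nat -> R).

(* Both identities expand, along its extra top row, an [n.+1]-square determinant
   whose columns are then combined by a unitriangular bidiagonal matrix. *)
Let bordered (t : nat -> R) : 'M[R]_n.+1 :=
  \matrix_(i, j) if unlift ord0 i is Some i' then G i' j else t j.

Let det_bordered t : \det (bordered t) =
  \sum_(j < n.+1) (-1) ^+ j * t j * \det (\matrix_(i < n, c < n) G i (bump j c)).
Proof.
rewrite (expand_det_row _ ord0); apply: eq_bigr => j _.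
rewrite mxE unlift_none /cofactor add0n mulrCA mulrA; congr (_ * \det _).
by apply/matrixP => i c; rewrite !mxE liftK.
Qed.

Lemma det_shift_down (w : R) :
  \det (\matrix_(i < n, c < n) (G i c.+1 + w * G i c)) =
  \sum_(j < n.+1) w ^+ j * \det (\matrix_(i < n, c < n) G i (bump j c)).
Proof.
(* With powers of [- w] on top, multiplication by [B] clears every entry of the top row but the
   first. *)
transitivity (\det (bordered (fun j => (- w) ^+ j))); last first.
  rewrite det_bordered; apply: eq_bigr => j _; congr (_ * _).
  by rewrite -exprMn mulN1r opprK.
pose B : 'M[R]_n.+1 := \matrix_(i, j) ((i == j)%:R + w * (i.+1 == j :> nat)%:R).
have detB : \det B = 1.
  rewrite -det_tr det_trig; last first.
    apply/is_trig_mxP => i j ij; rewrite !mxE.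
    have -> : (j == i) = false by apply/eqP => ji; rewrite ji ltnn in ij.
    by have -> : (j.+1 == i :> nat) = false by [lia]; rewrite mulr0 addr0.
  apply: big1 => i _; rewrite !mxE eqxx.
  by have -> : (i.+1 == i :> nat) = false by [lia]; rewrite mulr0 addr0.
have BE (t : nat -> R) i (j : 'I_n.+1) : (bordered t *m B) i j =
    bordered t i j + w * (if unlift ord0 j is Some j' then bordered t i (inord j') else 0).
  rewrite mxE.
  under eq_bigr => k _ do rewrite [B _ _]mxE mulrDr.
  rewrite big_split /= (bigD1 j) //= eqxx mulr1 big1 ?addr0; last first.
    by move=> k /negPf ->; rewrite mulr0.
  congr (_ + _); case: unliftP => [j' ->|->]; last first.
    by rewrite [w * 0]mulr0 big1 // => k _; rewrite !mulr0.
  rewrite (bigD1 (inord j')) // lift0 inordK; last exact: ltn_ordS.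
  rewrite eqxx mulr1 big1; first by rewrite /= addr0 mulrC.
  move=> k /eqP kj; rewrite eqSS; case: eqP => [kj'|_]; last by rewrite !mulr0.
  by case: kj; apply: val_inj; rewrite /= inordK ?ltn_ordS.
rewrite -[RHS]mulr1 -[X in _ = _ * X]detB -det_mulmx (expand_det_row _ ord0) big_ord_recl big1.
  rewrite addr0 BE unlift_none mulr0 addr0 mxE unlift_none expr0 mul1r.
  rewrite /cofactor expr0 mul1r; congr (\det _); apply/matrixP => i c.
  rewrite mxE [RHS]mxE [RHS]mxE BE liftK !mxE !liftK /= inordK ?ltn_ordS //.
move=> j _; rewrite BE liftK !mxE unlift_none lift0 inordK; last exact: ltn_ordS.
by rewrite exprS mulNr addNr mul0r.
Qed.

Lemma det_shift_up (z : R) :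
  \det (\matrix_(i < n, c < n) (G i c + z * G i c.+1)) =
  \sum_(j < n.+1) z ^+ (n - j) * \det (\matrix_(i < n, c < n) G i (bump j c)).
Proof.
(* With this top row, multiplication by [B] clears every entry but the last. *)
transitivity (\det (bordered (fun j => (-1) ^+ j * z ^+ (n - j)))); last first.
  rewrite det_bordered; apply: eq_bigr => j _; congr (_ * _).
  by rewrite mulrA -exprMn mulN1r opprK expr1n mul1r.
pose B : 'M[R]_n.+1 := \matrix_(i, j) ((i == j)%:R + z * (i == j.+1 :> nat)%:R).
have detB : \det B = 1.
  rewrite det_trig; last first.
    apply/is_trig_mxP => i j ij; rewrite !mxE.
    have -> : (i == j) = false by apply/eqP => ji; rewrite ji ltnn in ij.
    by have -> : (i == j.+1 :> nat) = false by [lia]; rewrite mulr0 addr0.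
  apply: big1 => i _; rewrite !mxE eqxx.
  by have -> : (i == i.+1 :> nat) = false by [lia]; rewrite mulr0 addr0.
have BE (t : nat -> R) i (j : 'I_n.+1) : (bordered t *m B) i j =
    bordered t i j + z * (if unlift ord_max j is Some j' then bordered t i (inord j'.+1) else 0).
  rewrite mxE.
  under eq_bigr => k _ do rewrite [B _ _]mxE mulrDr.
  rewrite big_split /= (bigD1 j) //= eqxx mulr1 big1 ?addr0; last first.
    by move=> k /negPf ->; rewrite mulr0.
  congr (_ + _); case: unliftP => [j' ->|->]; last first.
    rewrite [z * 0]mulr0 big1 // => k _.
    by rewrite (ltn_eqF (ltn_ord k)) !mulr0.
  rewrite (bigD1 (inord j'.+1)) // lift_max inordK; last by rewrite ltnS.
  rewrite eqxx mulr1 big1; first by rewrite /= addr0 mulrC.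
  move=> k /eqP kj; case: eqP => [kj'|_]; last by rewrite !mulr0.
  by case: kj; apply: val_inj; rewrite /= inordK ?ltnS.
rewrite -[RHS]mulr1 -[X in _ = _ * X]detB -det_mulmx (expand_det_row _ ord0) big_ord_recr big1 /=.
  rewrite add0r BE unlift_none mulr0 addr0 mxE unlift_none subnn expr0 mulr1.
  rewrite /cofactor add0n mulrA -exprMn mulN1r opprK expr1n mul1r.
  congr (\det _); apply/matrixP => i c.
  by rewrite mxE [RHS]mxE [RHS]mxE BE liftK !mxE !liftK lift_max inordK ?ltnS //.
move=> j _.
have -> : widen_ord (leqnSn n) j = lift ord_max j by apply: val_inj; rewrite /= /bump leqNgt ltn_ord.
rewrite BE liftK !mxE unlift_none lift_max inordK; last by rewrite ltnS.
have -> : (n - j = (n - j.+1).+1)%N by have := ltn_ord j; lia.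
by rewrite !exprS; set a := _ ^+ _; set b := _ ^+ _; rewrite (_ : _ + _ = 0) ?mul0r //; ring.
Qed.
End BidiagonalMinors.

Section Schur.
Variable R : comNzRingType.
Implicit Types h g : fps R.

Definition hz h (m : int) : R := if m is Posz k then h.[:k] else 0.

Lemma hz_neg h m : (m < 0)%R -> hz h m = 0. Proof. by case: m. Qed.

(** When g has degree at most D, the range of summation can be chosen independently of m, so that
    the same expansion applies to all entries of a determinant. *)
Lemma hz_mul D h g m : (forall k, (D < k)%N -> g.[:k] = 0) ->
  hz (h * g) m = \sum_(k < D.+1) g.[:k] * hz h (m - k%:Z).
Proof.
move=> gD; case: m => m; last first.
  by rewrite [LHS]hz_neg // big1 // => k _; rewrite hz_neg ?mulr0 //; lia.
rewrite -[LHS]/((h * g).[:m]) mulrC fps_coefM.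
pose F k := g.[:k] * hz h (m%:Z - k%:Z).
have -> : \sum_(i < m.+1) g.[:i] * h.[:m - i] = \sum_(i < m.+1) F i.
  by apply: eq_bigr => i _; rewrite /F subzn ?leq_ord.
rewrite -[RHS]/(\sum_(i < D.+1) F i).
pose N := (m + D).+1.
have -> : \sum_(i < m.+1) F i = \sum_(i < N) F i.
  rewrite (big_ord_widen N F) ?ltnS ?leq_addr //.
  rewrite [RHS](bigID (fun i : 'I__ => (i < m.+1)%N)) /= [X in _ + X]big1 ?addr0 //.
  by move=> i im; rewrite /F hz_neg ?mulr0 //; lia.
have -> : \sum_(i < D.+1) F i = \sum_(i < N) F i; last by [].
rewrite (big_ord_widen N F) ?ltnS ?leq_addl //.
rewrite [RHS](bigID (fun i : 'I__ => (i < D.+1)%N)) /= [X in _ + X]big1 ?addr0 //.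
by move=> i im; rewrite /F gD ?mul0r //; lia.
Qed.

Lemma hz_mul_lin h c m :
  hz (h * (1 + fps_const c * fps_var R)) m = hz h m + c * hz h (m - 1).
Proof.
rewrite (@hz_mul 1); last first.
  by move=> k k1; rewrite fps_coefD fps_coefCM; case: k k1 => [|[|k]] //= _; rewrite mulr0 addr0.
rewrite big_ord_recl big_ord1 !fps_coefD !fps_coefCM /= !mulr0 addr0 mulr1 add0r.
by rewrite subr0 mul1r.
Qed.

Definition schur n h (a : 'I_n -> int) : R :=
  \det (\matrix_(i < n, j < n) hz h (a i - i%:Z + j%:Z)).

Lemma det_sum_rows n (J : finType) (F : 'I_n -> J -> 'I_n -> R) :
  \det (\matrix_(i < n, j < n) \sum_k F i k j) =
  \sum_(f : {ffun 'I_n -> J}) \det (\matrix_(i < n, j < n) F i (f i) j).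
Proof.
rewrite /determinant exchange_big; apply: eq_bigr => s _.
rewrite -big_distrr; congr (_ * _) => /=.
under eq_bigr => i _ do rewrite mxE.
rewrite bigA_distr_bigA; apply: eq_bigr => f _; apply: eq_bigr => i _.
by rewrite mxE.
Qed.

Lemma det_scale_rows n (c : 'I_n -> R) (F : 'I_n -> 'I_n -> R) :
  \det (\matrix_(i < n, j < n) (c i * F i j)) =
  (\prod_i c i) * \det (\matrix_(i < n, j < n) F i j).
Proof.
rewrite /determinant big_distrr; apply: eq_bigr => s _ /=.
rewrite mulrCA -big_split; congr (_ * _) => /=; apply: eq_bigr => i _.
by rewrite !mxE.
Qed.

(** By multilinearity, each row i picks its own degree [A i] in g and is lowered by it. *)
Lemma schur_mul n D h g (a : 'I_n -> int) : (forall k, (D < k)%N -> g.[:k] = 0) ->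
  schur (h * g) a = \sum_(A : {ffun 'I_n -> 'I_D.+1})
    (\prod_i g.[:A i]) * schur h (fun i => a i - (A i)%:Z).
Proof.
move=> gD; rewrite /schur.
transitivity (\det (\matrix_(i < n, j < n)
  \sum_(k < D.+1) g.[:k] * hz h (a i - i%:Z + j%:Z - k%:Z))).
  by congr (\det _); apply/matrixP => i j; rewrite !mxE (hz_mul _ _ gD).
rewrite (det_sum_rows (fun (i : 'I_n) (k : 'I_D.+1) (j : 'I_n) =>
  g.[:k] * hz h (a i - i%:Z + j%:Z - k%:Z))).
apply: eq_bigr => A _.
rewrite (det_scale_rows (fun i => g.[:A i])); congr (_ * \det _).
by apply/matrixP => i j; rewrite !mxE; congr hz; ring.
Qed.

(** The entries are shifted by -1 because these rows sit below a new first row; column j is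
    deleted. *)
Definition schur_minor n h (a : 'I_n -> int) (j : nat) : R :=
  \det (\matrix_(i < n, c < n) hz h (a i - i%:Z + (bump j c)%:Z - 1)).

(** The minors met when a first row is added on top are thus the coefficients, in powers of c, of
    one determinant with n rows. *)
Lemma schur_minorE n h (a : 'I_n -> int) c :
  schur (h * (1 + fps_const c * fps_var R)) a =
  \sum_(j < n.+1) c ^+ j * schur_minor h a j.
Proof.
pose G (i : 'I_n) (k : nat) := hz h (a i - i%:Z + k%:Z - 1).
rewrite -[RHS](det_shift_down G c); congr (\det _); apply/matrixP => i j.
rewrite !mxE hz_mul_lin /G -addn1 PoszD; congr (hz _ _ + _); ring.
Qed.

Lemma schur_recl n h (a : 'I_n.+1 -> int) :
  schur h a = \sum_(j < n.+1) (-1) ^+ j * hz h (a ord0 + j%:Z) *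
    schur_minor h (fun i => a (lift ord0 i)) j.
Proof.
rewrite /schur (expand_det_row _ ord0); apply: eq_bigr => j _.
rewrite mxE /cofactor add0n subr0 mulrCA mulrA; congr (_ * \det _).
apply/matrixP => i c; rewrite !mxE; congr hz; rewrite lift0 /=; lia.
Qed.

Lemma det_upper_unitriangular n (M : 'M[R]_n) :
  (forall i, M i i = 1) -> (forall i j : 'I_n, (j < i)%N -> M i j = 0) -> \det M = 1.
Proof.
move=> M1 M0; rewrite -det_tr det_trig; last by apply/is_trig_mxP => i j ij; rewrite mxE M0.
by apply: big1 => i _; rewrite mxE M1.
Qed.

(** The elementary function e_k(h), that is, s_a(h) for a = (1^k). *)
Definition elem h (k : nat) : R := \det (\matrix_(i < k, j < k) hz h (1 - i%:Z + j%:Z)).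

(** Both matrices are block upper triangular with the same upper left block. The lower right block
    is unitriangular for [schur h a], and skipping column m turns it into the matrix of e_k. *)
Lemma schur_skip m k h (a : 'I_(m + k) -> int) : h.[:0] = 1 ->
  (forall i : 'I_(m + k), (m <= i)%N -> a i = 0) ->
  \det (\matrix_(i < m + k, c < m + k) hz h (a i - i%:Z + (bump m c)%:Z)) =
  elem h k * schur h a.
Proof.
move=> h0 a0.
set M := \matrix_(i < m + k, c < m + k) _.
have blk (N : 'M[R]_(m + k)) : (forall i j, N (rshift m i) (lshift k j) = 0) ->
    \det N = \det (ulsubmx N) * \det (drsubmx N).
  move=> N0; rewrite -{1}[N]submxK (_ : dlsubmx N = 0) ?det_ublock //.
  by apply/matrixP => i j; rewrite !mxE N0.
rewrite /schur !blk.
- rewrite [X in _ = _ * (_ * X)]det_upper_unitriangular.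
  + rewrite mulr1 mulrC /elem; congr (_ * _); congr (\det _); apply/matrixP => i j; rewrite !mxE.
      by rewrite a0 ?leq_addr //=; congr hz; rewrite /bump leq_addr; lia.
    by congr hz; rewrite /= /bump leqNgt ltn_ord; lia.
  + by move=> i; rewrite !mxE a0 ?leq_addr //= (_ : _ + _ = 0%:Z) //; lia.
  + by move=> i j ij; rewrite !mxE a0 ?leq_addr //= hz_neg //; lia.
- by move=> i j; rewrite !mxE a0 ?leq_addr //= hz_neg //; have := ltn_ord j; lia.
- move=> i j; rewrite !mxE a0 ?leq_addr //= hz_neg //; have := ltn_ord j.
  by rewrite /bump; lia.
Qed.

Lemma schur_zero n h : h.[:0] = 1 -> schur h (fun _ : 'I_n => 0) = 1.
Proof.
move=> h0; apply: det_upper_unitriangular => [i|i j ij]; rewrite mxE.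
  by rewrite (_ : _ + _ = 0%:Z) //; lia.
by rewrite hz_neg //; lia.
Qed.

(** Expansion along the first row; [schur_skip] at the zero vector evaluates the minors. *)
Lemma elem_rec n h : h.[:0] = 1 ->
  elem h n.+1 = \sum_(j < n.+1) (-1) ^+ j * h.[:j.+1] * elem h (n - j).
Proof.
move=> h0; rewrite -[elem h n.+1]/(schur h (fun _ : 'I_n.+1 => 1)) schur_recl.
apply: eq_bigr => -[j /= jn] _; congr (_ * _ * _).
rewrite /schur_minor.
have E : (n = j + (n - j))%N by lia.
set k := (n - j)%N in E *; clearbody k; subst n.
rewrite -[RHS]mulr1 -(@schur_zero (j + k) h) // -schur_skip //.
by congr (\det _); apply/matrixP => i c; rewrite !mxE; congr hz; lia.
Qed.

(** The recurrence [elem_rec] says that h(-z) E(z) = 1. *)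
Lemma elemE h k : h.[:0] = 1 -> elem h k = (fps_inv (fps_scale (-1) h)).[:k].
Proof.
move=> h0; set E := Fps (elem h).
suff EE : fps_scale (-1) h * E = 1.
  have s0 : (fps_scale (-1) h).[:0] = 1 by rewrite /= mul1r.
  by rewrite -[fps_inv _]mulr1 -EE mulrCA mulrA fps_mulVr // mul1r.
apply: fpsP => -[|n]; first by rewrite fps_coefM0 /= h0 !mul1r [elem _ _]det_mx00.
rewrite fps_coefM big_ord_recl /= h0 !mul1r subn0 elem_rec // -big_split big1 //=.
by move=> i _; rewrite subSS exprS !mulN1r !mulNr subrr.
Qed.

(* Pieri rule, in the range where no row beyond the [n] available ones is created. *)
Lemma schur_pieri n h (a : 'I_n -> int) (z : R) l : h.[:0] = 1 -> (l <= n)%N ->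
  (forall i : 'I_n, (l <= i)%N -> a i = 0) ->
  exists r, \det (\matrix_(i < n, c < n)
      (hz h (a i - i%:Z + c%:Z) + z * hz h (a i - i%:Z + c.+1%:Z))) =
    (\sum_(k < (n - l).+1) z ^+ k * (fps_inv (fps_scale (-1) h)).[:k]) * schur h a
      + z ^+ (n - l).+1 * r.
Proof.
move=> h0 ln a0.
rewrite (det_shift_up (fun i c => hz h (a i - i%:Z + c%:Z))).
pose D j := \det (\matrix_(i < n, c < n) hz h (a i - i%:Z + (bump j c)%:Z)).
(* The minors with j < l carry z^(n - j) with n - j > n - l and form the remainder; the others are
   given by [schur_skip]. *)
exists (\sum_(j < l) z ^+ (l - j).-1 * D j).
rewrite -(big_mkord xpredT (fun j => z ^+ (n - j) * D j)).
rewrite (@big_cat_nat _ _ _ l) //= ?(leq_trans ln) // addrC; congr (_ + _); last first.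
  rewrite big_mkord big_distrr; apply: eq_bigr => j _ /=.
  by rewrite mulrA -exprD; congr (_ ^+ _ * _); have := ltn_ord j; lia.
pose F k := z ^+ k * (fps_inv (fps_scale (-1) h)).[:k] * schur h a.
transitivity (\sum_(0 <= k < (n - l).+1) F k); last by rewrite big_mkord big_distrl.
rewrite -{1}[l]add0n big_addn subSn // big_nat_rev [LHS]big_nat [RHS]big_nat.
apply: eq_bigr => k /andP[_ kn]; rewrite add0n subSS /F -mulrA; congr (_ ^+ _ * _); first lia.
rewrite -elemE // /D.
have -> : (n - l - k + l = n - k)%N by lia.
set m := (n - k)%N.
have E : (n = m + k)%N by lia.
have lm : (l <= m)%N by lia.
clearbody m; clear kn; subst n; apply: schur_skip => // i im; apply: a0; lia.
Qed.
End Schur.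

Lemma hz_map (R S : comNzRingType) (phi : {rmorphism R -> S}) h m :
  hz (fps_map phi h) m = phi (hz h m).
Proof. by case: m => m //=; rewrite rmorph0. Qed.

Lemma schur_map (R S : comNzRingType) (phi : {rmorphism R -> S}) n h (a : 'I_n -> int) :
  schur (fps_map phi h) a = phi (schur h a).
Proof.
rewrite -det_map_mx; congr (\det _); apply/matrixP => i j.
by rewrite !mxE hz_map.
Qed.

Lemma schur_minor_map (R S : comNzRingType) (phi : {rmorphism R -> S}) n h (a : 'I_n -> int) j :
  schur_minor (fps_map phi h) a j = phi (schur_minor h a j).
Proof.
rewrite -det_map_mx; congr (\det _); apply/matrixP => i c.
by rewrite !mxE hz_map.
Qed.

(** * The functional equation *)

Section Elementary.
Variable R : comNzRingType.
Implicit Types (c : R) (f : fps R).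

Definition lin c : fps R := 1 + fps_const c * fps_var R.
Definition geo c : fps R := Fps (fun n => c ^+ n).

Lemma lin0 : lin 0 = 1. Proof. by rewrite /lin rmorph0 mul0r addr0. Qed.

Lemma lin_geo c : lin (- c) * geo c = 1.
Proof.
apply: fpsP => n; rewrite mulrDl mul1r fps_coefD -mulrA fps_coefCM fps_coefXM fps_coef1.
by case: n => [|n] /=; rewrite ?mulr0 ?addr0 // exprS mulNr addrN.
Qed.

Lemma lin_ct c : (lin c).[:0] = 1.
Proof. by rewrite fps_coefD fps_coefCM /= mulr0 addr0. Qed.

Lemma scale_ct a f : (fps_scale a f).[:0] = f.[:0].
Proof. by rewrite /= mul1r. Qed.

Lemma scale_lin a c : fps_scale a (lin c) = lin (a * c).
Proof.
rewrite rmorphD rmorph1 rmorphM /= fps_scaleC fps_scaleX /lin rmorphM /=; ring.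
Qed.

Lemma scale_geo a c : fps_scale a (geo c) = geo (a * c).
Proof. by apply: fpsP => n /=; rewrite exprMn. Qed.

Lemma fps_invP f g : f.[:0] = 1 -> f * g = 1 -> g = fps_inv f.
Proof. by move=> f0 fg; rewrite -[fps_inv f]mulr1 -fg mulrCA mulrA fps_mulVr ?mul1r. Qed.

Lemma scale_inv a f : f.[:0] = 1 -> fps_scale a (fps_inv f) = fps_inv (fps_scale a f).
Proof.
move=> f0; apply: fps_invP; first by rewrite scale_ct.
by rewrite -rmorphM /= fps_mulVr // rmorph1.
Qed.

Lemma diag_map_const f : fps_diag (fps_map (@fps_const R) f) = f.
Proof.
apply: fpsP => n /=; rewrite big_ord_recr /= subnn big1 ?add0r // => i _.
by have := ltn_ord i; case E: (n - i)%N => //; lia.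
Qed.

(** Truncates F(z, z) so that it can be compared with the truncated sum of [schur_pieri]. *)
Lemma diag_split M (F : fps (fps R)) : exists r,
  fps_diag F = \sum_(k < M.+1) fps_var R ^+ k * F.[:k] + fps_var R ^+ M.+1 * r.
Proof.
elim: M F => [|M IH] F.
  exists (fps_diag (Fps (fun n => F.[:n.+1]))).
  by rewrite big_ord1 [in LHS](fps_decomp F) fps_diagD fps_diagC fps_diagXM mul1r.
have [r E] := IH (Fps (fun n => F.[:n.+1])); exists r.
rewrite [in LHS](fps_decomp F) fps_diagD fps_diagC fps_diagXM E.
rewrite [in RHS]big_ord_recl expr0 mul1r -addrA [X in _ + X = _]mulrDr [X in _ + (X + _) = _]big_distrr mulrA -exprS; congr (_ + (_ + _)).
by apply: eq_bigr => i _; rewrite lift0 exprS -mulrA.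
Qed.
End Elementary.

Section ElementaryMap.
Variables (R S : comNzRingType) (phi : {rmorphism R -> S}).
Lemma map_lin c : fps_map phi (lin c) = lin (phi c).
Proof. by rewrite rmorphD rmorphM /= rmorph1 fps_mapC fps_mapX. Qed.
End ElementaryMap.

Section QSeries.
Variables (R : comNzRingType) (q : R) (D : nat).
Hypothesis q_nilp : q ^+ D.+1 = 0.
Implicit Types (c : R) (h : fps R).

Definition qprod c : fps R := \prod_(1 <= k < D.+1) lin (q ^+ k * c).

(** The factor of index D+1 is 1 because q^(D+1) = 0, so the finite product obeys the functional
    equation of the infinite one. *)
Lemma qprod_shift c : qprod c = lin (q * c) * qprod (q * c).
Proof.
rewrite /qprod; transitivity (\prod_(1 <= k < D.+2) lin (q ^+ k * c)).
  by rewrite [RHS]big_nat_recr //= q_nilp mul0r lin0 mulr1.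
rewrite big_ltn // expr1 big_add1 /= !big_add1 /=; congr (_ * _).
by apply: eq_bigr => k _; rewrite !exprSr !mulrA.
Qed.

Lemma scale_qprod a c : fps_scale a (qprod c) = qprod (a * c).
Proof.
by rewrite rmorph_prod; apply: eq_bigr => k _; rewrite /= scale_lin mulrCA.
Qed.

Lemma qprod_ct c : (qprod c).[:0] = 1.
Proof.
rewrite -[LHS]/(ctcoef (qprod c)) rmorph_prod big1 // => k _; exact: lin_ct.
Qed.

Lemma coef_qprod c b : (qprod c).[:b] = c ^+ b * (qprod 1).[:b].
Proof. by rewrite -[c in LHS]mulr1 -scale_qprod. Qed.
End QSeries.

Section QSeriesMap.
Variables (R S : comNzRingType) (phi : {rmorphism R -> S}) (q : R) (D : nat).
Lemma map_qprod c : fps_map phi (qprod q D c) = qprod (phi q) D (phi c).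
Proof.
rewrite rmorph_prod; apply: eq_bigr => k _.
by rewrite /= map_lin rmorphM rmorphXn.
Qed.
End QSeriesMap.

Section FunctionalEquation.
Variables (R : comNzRingType) (q : R) (D : nat).
Hypothesis q_nilp : q ^+ D.+1 = 0.
Implicit Types (c : R) (h : fps R).

(* prod_(k >= 1) (1 - q^k z^2), as the diagonal of prod_(k >= 1) (1 - q^k y z). *)
Definition qpair : fps R := fps_diag (qprod (fps_const q) D (- fps_var R)).
Definition kernel h := qpair * fps_scale (-1) h.
(** Iterating K(z) Z(z) = Z(qz) from Z(0) = 1 gives the product of the 1/K(q^k z), which stops at k
    = D by nilpotency. *)
Definition solution h := \prod_(k < D.+1) fps_inv (fps_scale (q ^+ k) (kernel h)).

(** Only even powers occur; testing [n == b + b] inside a sum replaces a case split on parity. *)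
Lemma coef_qpair n : qpair.[:n] =
  \sum_(b < n.+1) (if n == (b + b)%N then (-1) ^+ b * (qprod q D 1).[:b] else 0).
Proof.
rewrite /qpair /=; apply: eq_bigr => b _.
rewrite [in LHS]coef_qprod (_ : qprod (fps_const q) D 1 = fps_map (@fps_const R) (qprod q D 1)); last first.
  by rewrite map_qprod /= rmorph1.
rewrite -[_.[:b]]/(fps_const (qprod q D 1).[:b]) -[- fps_var R]mulN1r exprMn -mulrA -(rmorphN1 (@fps_const R)) -rmorphXn fps_coefCM fps_coefXnM.
have -> : (n == b + b)%N = (n - b == b)%N by have := ltn_ord b; lia.
case: eqP => [->|bn]; first by rewrite leqnn subnn.
case: leqP => nb; rewrite ?mulr0 //.
by case E: (n - b - b)%N => [|k] /=; rewrite ?mulr0 //; lia.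
Qed.

Lemma kernel_ct h : h.[:0] = 1 -> (kernel h).[:0] = 1.
Proof. by move=> h0; rewrite fps_coefM0 /= h0 !mulr1 big_ord1 !qprod_ct. Qed.

Lemma solution_ct h : (solution h).[:0] = 1.
Proof.
rewrite -[LHS]/(ctcoef (solution h)) rmorph_prod big1 // => k _; exact: fps_inv0.
Qed.

(** Substituting qz shifts the product by one factor; the new last factor is taken at q^(D+1) z = 0,
    where it equals 1. *)
Lemma solution_eq h : h.[:0] = 1 ->
  kernel h * solution h = fps_scale q (solution h).
Proof.
move=> h0; have k0 := kernel_ct h0.
have s0 k : (fps_scale (q ^+ k) (kernel h)).[:0] = 1 by rewrite scale_ct.
rewrite /solution rmorph_prod.
under [RHS]eq_bigr => k _ do rewrite /= scale_inv // fps_scaleA -exprS.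
rewrite big_ord_recl expr0 fps_scale1 mulrA fps_mulVr // mul1r.
by rewrite [RHS]big_ord_recr /= q_nilp fps_scale0 k0 rmorph1 fps_inv1 mulr1.
Qed.

(** From a = q^n a follows a = q^(nk) a for all k, and q is nilpotent. *)
Lemma mulr_1Bq_eq0 n (a : R) : (0 < n)%N -> (1 - q ^+ n) * a = 0 -> a = 0.
Proof.
move=> n0 /eqP; rewrite mulrBl mul1r subr_eq0 => /eqP E.
have {}E k : a = q ^+ (n * k) * a.
  elim: k => [|k IH]; first by rewrite muln0 mul1r.
  by rewrite mulnS exprD -mulrA -IH.
rewrite (E D.+1) (_ : n * D.+1 = D.+1 + n.-1 * D.+1)%N; last by nia.
by rewrite exprD q_nilp !mul0r.
Qed.

(** Once the lower coefficients of the difference d vanish, the equation in degree n reads (1 - q^n)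
    d_n = 0. *)
Lemma solution_uniq h f : h.[:0] = 1 -> f.[:0] = 1 ->
  kernel h * f = fps_scale q f -> f = solution h.
Proof.
move=> h0 f0 Ef; have Es := solution_eq h0; have k0 := kernel_ct h0.
pose d := f - solution h.
have Ed : kernel h * d = fps_scale q d by rewrite mulrBr rmorphB /= Ef Es.
have d0 n : d.[:n] = 0.
  elim/ltn_ind: n => -[|n] IH; first by rewrite fps_coefB f0 solution_ct subrr.
  apply: (@mulr_1Bq_eq0 n.+1) => //; rewrite mulrBl mul1r.
  rewrite -[_ ^+ _ * _]/((fps_scale q d).[:n.+1]) -Ed fps_coefM big_ord_recl k0 mul1r subn0.
  rewrite opprD addrA subrr sub0r big1 ?oppr0 // => i _.
  by rewrite IH ?mulr0 // lift0; lia.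
by apply/eqP; rewrite -subr_eq0; apply/eqP/fpsP => n; rewrite d0 fps_coef0.
Qed.
End FunctionalEquation.

(** * Sums over highest weight words *)

Section Words.
Variable N : nat.
Implicit Types (mu : 'I_N -> int) (a : 'I_(N + N)) (m k p : nat).

Definition add_letter a mu (t : 'I_N) : int := mu t + letter_wt a t.

Lemma letter_wt_unbarred a t : (a < N)%N -> letter_wt a t = (t == a :> nat)%:Z.
Proof. by move=> aN; rewrite /letter_wt aN. Qed.

Lemma letter_wt_barred a t : (N <= a)%N ->
  letter_wt a t = - (t == ((N + N).-1 - a)%N :> nat)%:Z.
Proof. by move=> aN; rewrite /letter_wt ltnNge aN. Qed.

Lemma partition_vecP mu : reflect
  ((forall i, 0 <= mu i) /\ (forall i j : 'I_N, (i <= j)%N -> mu j <= mu i))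
  (is_partition_vec mu).
Proof.
apply: (iffP andP) => -[/forallP h1 h2]; split=> //.
  by move=> i j ij; move/forallP/(_ i)/forallP/(_ j)/implyP: h2; apply.
by apply/forallP => i; apply/forallP => j; apply/implyP; apply: h2.
Qed.

Section Sums.
Variables (R : comNzRingType) (q : R).

(* The weight of a word is [q ^ (energy + number of barred letters)]. The letter read
   just before it is [p.-1], and [p = 0] encodes the absence of such a letter. *)
Fixpoint word_sum (g : ('I_N -> int) -> R) m mu p : R :=
  if m is m'.+1 then
    \sum_(a : 'I_(N + N) | is_partition_vec (add_letter a mu))
      q ^+ (m * (a < p) + (N <= a)) * word_sum g m' (add_letter a mu) a.+1
  else g mu.

(** One strictly increasing run of k letters, all at least p. Such a run has no energy, so only the
    bars are weighted. *)
Fixpoint incr_sum (g : ('I_N -> int) -> R) k mu p : R :=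
  if k is k'.+1 then
    \sum_(a : 'I_(N + N) | is_partition_vec (add_letter a mu) && (p <= a)%N)
      q ^+ (N <= a)%N * incr_sum g k' (add_letter a mu) a.+1
  else g mu.

(** The falling product (q)_m / (q)_(m-k) for k at most m; [qfall m m] is (q)_m. *)
Definition qfall m k : R := \prod_(i < k) (1 - q ^+ (m - i)).

Lemma qfallS m k : qfall m.+1 k.+1 = (1 - q ^+ m.+1) * qfall m k.
Proof.
by rewrite /qfall big_ord_recl subn0.
Qed.

Lemma qfall_split m k : (k <= m)%N -> qfall m k * qfall (m - k) (m - k) = qfall m m.
Proof.
move=> km; rewrite /qfall -[in RHS](subnKC km) big_split_ord /=; congr (_ * _).
  by apply: eq_bigr => i _; rewrite subnKC.
by apply: eq_bigr => i _; rewrite subnKC // subnDA.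
Qed.

(* q^(m [a < p]) = q^m + (1 - q^m) [p <= a]: each letter either ignores its
   predecessor or prolongs a strictly increasing run. *)
Lemma word_sum_incr g m mu p :
  word_sum g m mu p = \sum_(k < m.+1) q ^+ (m - k) * qfall m k *
    incr_sum (fun nu => word_sum g (m - k) nu 0) k mu p.
Proof.
elim: m mu p => [|m IH] mu p.
  by rewrite big_ord1 /= /qfall big_ord0 subnn expr0 !mul1r.
rewrite big_ord_recl [qfall _ ord0]big_ord0 mulr1 subn0.
transitivity (q ^+ m.+1 * word_sum g m.+1 mu 0 + (1 - q ^+ m.+1) *
   \sum_(a : 'I_(N + N) | is_partition_vec (add_letter a mu) && (p <= a)%N)
      q ^+ (N <= a)%N * word_sum g m (add_letter a mu) a.+1).
  rewrite [word_sum g m.+1 mu p]/= [X in _ = _ + _ * X]big_mkcondr /= !big_distrr -big_split.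
  apply: eq_bigr => a _ /=; rewrite [(a < p)%N]ltnNge.
  by case: (p <= a)%N; rewrite /= ?muln0 ?muln1 ?add0n ?exprD; ring.
congr (_ + _).
under eq_bigr => a _ do rewrite IH big_distrr.
rewrite exchange_big big_distrr; apply: eq_bigr => k _.
rewrite lift0 subSS qfallS !big_distrr; apply: eq_bigr => a _ /=.
rewrite -/incr_sum; ring.
Qed.

(** A letter changes one coordinate, so it can open at most one new row while the vector stays a
    partition. Hence g matters only on partitions with at most l + k rows. *)
Lemma eq_incr_sum g g' k mu p l :
  is_partition_vec mu -> (forall i : 'I_N, (l <= i)%N -> mu i = 0) ->
  (forall nu, is_partition_vec nu -> (forall i : 'I_N, (l + k <= i)%N -> nu i = 0) ->
     g nu = g' nu) ->
  incr_sum g k mu p = incr_sum g' k mu p.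
Proof.
elim: k mu p l => [|k IH] mu p l mup mul gg' /=.
  by apply: gg' => // i; rewrite addn0; apply: mul.
apply: eq_bigr => a /andP[ap _]; congr (_ * _).
apply: (IH _ _ l.+1) => // [i li|nu nup nul]; last first.
  by apply: gg' => // i; rewrite addnS -addSn; apply: nul.
have /partition_vecP[pos dec] := ap; have mi := mul i (ltnW li).
have il : (l < N)%N by apply: leq_trans (ltn_ord i); lia.
have := dec (Ordinal il) i (ltnW li); have := pos i.
rewrite /add_letter mi mul //.
case: (ltnP a N) => aN; first by rewrite !letter_wt_unbarred //=; lia.
rewrite !letter_wt_barred //=; lia.
Qed.

Lemma incr_sum_large g k mu p : (N + N - p < k)%N -> incr_sum g k mu p = 0.
Proof.
elim: k mu p => [|k IH] mu p //= pk; apply: big1 => a /andP[_ pa].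
by rewrite IH ?mulr0 //; have := ltn_ord a; lia.
Qed.

Definition incr_gen (g : ('I_N -> int) -> R) (y : R) p mu :=
  \sum_(k < (N + N).+1) y ^+ k * incr_sum g k mu p.

(** Either the run avoids the letter [a], or it begins with it. *)
Lemma incr_gen_rec g y a mu : incr_gen g y a mu = incr_gen g y a.+1 mu +
  (if is_partition_vec (add_letter a mu) then
     y * q ^+ (N <= a)%N * incr_gen g y a.+1 (add_letter a mu) else 0).
Proof.
have E k : incr_sum g k.+1 mu a = incr_sum g k.+1 mu a.+1 +
   (if is_partition_vec (add_letter a mu) then
     q ^+ (N <= a)%N * incr_sum g k (add_letter a mu) a.+1 else 0).
  rewrite /= [LHS](bigID (pred1 a)) /= addrC; congr (_ + _).
    apply: eq_bigl => b; rewrite -andbA; congr (_ && _).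
    by rewrite ltn_neqAle andbC eq_sym.
  case: ifP => ap; last first.
    by rewrite big_pred0 // => b; case: eqP => [->|]; rewrite ?ap ?andbF.
  rewrite (big_pred1 a) // => b /=; case: eqP => [->|]; by rewrite ?ap ?leqnn ?andbF.
rewrite /incr_gen big_ord_recl [in RHS]big_ord_recl -addrA; congr (_ + _).
under eq_bigr => k _ do rewrite lift0 E mulrDr.
rewrite big_split /=; congr (_ + _).
case: ifP => _; last by rewrite big1 // => k _; rewrite mulr0.
rewrite [in RHS]big_ord_recr /= incr_sum_large ?mulr0 ?addr0; last by have := ltn_ord a; lia.
by rewrite big_distrr; apply: eq_bigr => k _ /=; rewrite exprS; ring.
Qed.

Lemma incr_gen_last g y mu : incr_gen g y (N + N) mu = g mu.
Proof.
rewrite /incr_gen big_ord_recl expr0 mul1r big1 ?addr0 // => k _.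
by rewrite incr_sum_large ?mulr0 // subnn.
Qed.

(** * Generating functions of increasing runs as determinants *)

Section Transfer.
Variables (h : fps R) (y : R).

Definition tail_entry p (i : 'I_N) (m : int) : R :=
  let u (m : int) := hz h m + (if (p <= (N + N).-1 - i)%N then y * q * hz h (m - 1) else 0) in
  u m + (if (p <= i)%N then y * u (m + 1) else 0).

(* The sum of y^|S| q^(barred letters of S) s_(mu + wt S) over all sets S of
   letters at least p: row i carries one factor for the letter i and one for its bar. *)
Definition tail_det p mu : R :=
  \det (\matrix_(i < N, c < N) tail_entry p i (mu i - i%:Z + c%:Z)).

(** The letter [a] affects a single row r. In that row, the factor for [a] splits the entry into two
    terms, and the determinant is linear in the row. *)
Lemma tail_det_rec a mu : tail_det a mu = tail_det a.+1 mu +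
  y * q ^+ (N <= a)%N * tail_det a.+1 (add_letter a mu).
Proof.
have Na := ltn_ord a.
have [r [rE re]] : exists r : 'I_N, ((a == r :> nat) || (a == ((N + N).-1 - r)%N :> nat)) /\
    forall i : 'I_N, i != r -> (a != i :> nat) && (a != ((N + N).-1 - i)%N :> nat).
  case: (ltnP a N) => aN.
    exists (Ordinal aN); split=> [|i]; first by rewrite eqxx.
    by rewrite -val_eqE /=; have := ltn_ord i; lia.
  have bN : ((N + N).-1 - a < N)%N by lia.
  exists (Ordinal bN); split=> [|i]; first by apply/orP; right; apply/eqP => /=; lia.
  by rewrite -val_eqE /=; have := ltn_ord i; lia.
rewrite -[tail_det a.+1 mu]mul1r; apply: (@determinant_multilinear _ _ _ _ _ r).
- apply/rowP => c; rewrite !mxE mul1r /add_letter.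
  case: (ltnP a N) => aN /=.
  + have ra : r = a :> nat by move: rE; have := ltn_ord r; lia.
    rewrite letter_wt_unbarred // ra eqxx expr0 mulr1 /tail_entry ra leqnn ltnn.
    have -> : (a <= (N + N).-1 - a)%N by lia.
    have -> : (a < (N + N).-1 - a)%N by lia.
    by rewrite !addr0; congr (_ + y * (hz h _ + _ * hz h _)); lia.
  + have ra : ((N + N).-1 - a = r)%N by move: rE; have := ltn_ord r; lia.
    have ar : ((N + N).-1 - r = a)%N by move: rE; have := ltn_ord r; lia.
    rewrite letter_wt_barred // ra eqxx expr1 /tail_entry ar leqnn ltnn.
    have -> : (a <= r)%N = false by have := ltn_ord r; lia.
    have -> : (a < r)%N = false by have := ltn_ord r; lia.
    by rewrite !addr0; congr (_ + _ * hz h _); lia.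
- apply/matrixP => i c; rewrite !mxE /tail_entry.
  have ir : lift r i != r by rewrite eq_sym neq_lift.
  have /andP[h1 h2] := re _ ir.
  by rewrite !ltn_neqAle h1 h2.
- apply/matrixP => i c; rewrite !mxE /tail_entry /add_letter.
  have ir : lift r i != r by rewrite eq_sym neq_lift.
  have /andP[h1 h2] := re _ ir.
  have -> : letter_wt a (lift r i) = 0.
    case: (ltnP a N) => aN; first by rewrite letter_wt_unbarred // eq_sym (negPf h1).
    rewrite letter_wt_barred //.
    have -> : (nat_of_ord (lift r i) == ((N + N).-1 - a)%N) = false; last by [].
    by apply/negbTE; have := ltn_ord (lift r i); lia.
  by rewrite addr0 !ltn_neqAle h1 h2.
Qed.

Lemma tail_det_last mu : tail_det (N + N) mu = schur h mu.
Proof.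
congr (\det _); apply/matrixP => i c; rewrite !mxE /tail_entry.
have iN := ltn_ord i.
have -> : (N + N <= (N + N).-1 - i)%N = false by lia.
have -> : (N + N <= i)%N = false by lia.
by rewrite !addr0.
Qed.

(** With all letters allowed, the bars are absorbed into h as the factor 1 + yqz; the unbarred
    letters leave the determinant of [schur_pieri]. *)
Lemma tail_det_first mu : let G := h * lin (y * q) in
  tail_det 0 mu = \det (\matrix_(i < N, c < N)
      (hz G (mu i - i%:Z + c%:Z) + y * hz G (mu i - i%:Z + c.+1%:Z))).
Proof.
move=> G; congr (\det _); apply/matrixP => i c; rewrite !mxE /tail_entry !leq0n.
rewrite !hz_mul_lin; congr (_ + y * (hz h _ + _ * hz h _)); lia.
Qed.

(** If [a] breaks the partition, it has acted on one of two equal adjacent parts, and the threshold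
    [a.+1] gives both rows the same factors, so they coincide. The other case is a bar acting on a
    zero last part, where all indices in the row become negative. *)
Lemma tail_det_vanish a mu : is_partition_vec mu ->
  ~~ is_partition_vec (add_letter a mu) -> tail_det a.+1 (add_letter a mu) = 0.
Proof.
move=> mup amup; have Na := ltn_ord a; have /partition_vecP[pos dec] := mup.
have eqrows (i j : 'I_N) : i != j ->
    (a.+1 <= (N + N).-1 - i)%N = (a.+1 <= (N + N).-1 - j)%N ->
    (a.+1 <= i)%N = (a.+1 <= j)%N ->
    add_letter a mu i - i%:Z = add_letter a mu j - j%:Z ->
    tail_det a.+1 (add_letter a mu) = 0.
  move=> ij e1 e2 e3; apply: (determinant_alternate ij) => c.
  by rewrite !mxE /tail_entry e1 e2 e3.
case: (ltnP a N) => aN.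
  (* The [insubd] term is the previous row, as [a.-1] lies below N. *)
  case: (boolP ((0 < a)%N && (mu (insubd (Ordinal aN) a.-1) == mu (Ordinal aN)))).
    case/andP => a0 /eqP mua.
    set j := insubd (Ordinal aN) a.-1 in mua *.
    have jE : j = a.-1 :> nat by rewrite val_insubd; case: ifP => //; lia.
    apply: (eqrows j (Ordinal aN)); rewrite -?val_eqE /= ?jE; try lia.
    by rewrite /add_letter mua !letter_wt_unbarred //= jE eqxx; lia.
  move=> H; case/negP: amup; apply/partition_vecP; split=> [i|i j ij].
    by rewrite /add_letter letter_wt_unbarred //; have := pos i; lia.
  rewrite /add_letter !letter_wt_unbarred //; have := dec i j ij.
  case: (nat_of_ord j =P a) => [ja|]; last by lia.
  case: (nat_of_ord i =P a) => [ia|ia] /=; first by lia.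
  have a0 : (0 < a)%N by lia.
  have jO : j = Ordinal aN by apply: val_inj.
  move: H; rewrite a0 /=; set k := insubd _ _.
  have kE : k = a.-1 :> nat by rewrite val_insubd; case: ifP => //; lia.
  have := dec i k; have := dec k j; rewrite jO kE => h1 h2 /eqP h3 h4.
  have := h1 _; have := h2 _; rewrite /= => h5 h6.
  have {}h5 := h5 ltac:(lia); have {}h6 := h6 ltac:(lia); lia.
have bN : ((N + N).-1 - a < N)%N by lia.
set r := Ordinal bN.
case: (boolP (r.+1 == N)) => [/eqP rN|rN].
  case: (boolP (mu r == 0)) => [/eqP mr0|mr].
    rewrite /tail_det (expand_det_row _ r) big1 // => c _.
    rewrite mxE /tail_entry.
    have -> : (a < (N + N).-1 - r)%N = false by rewrite /=; lia.
    have -> : (a < r)%N = false by rewrite /=; lia.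
    rewrite !addr0 hz_neg ?mul0r // /add_letter mr0 letter_wt_barred //= eqxx.
    by have := ltn_ord c; move: rN => /=; lia.
  case/negP: amup; apply/partition_vecP; split=> [i|i j ij].
    rewrite /add_letter letter_wt_barred //; have := pos i.
    case: eqP => /= [ir|]; last by lia.
    have -> : i = r by apply: val_inj.
    by have := pos r; move/eqP: mr; lia.
  rewrite /add_letter !letter_wt_barred //; have := dec i j ij.
  move: rN => /=; have := ltn_ord j; lia.
have sN : (r.+1 < N)%N by have := ltn_ord r; lia.
case: (boolP (mu r == mu (Ordinal sN))) => [/eqP mrs|mrs].
  apply: (eqrows r (Ordinal sN)); rewrite -?val_eqE /=; try lia.
  by rewrite /add_letter mrs !letter_wt_barred //= eqxx; lia.
case/negP: amup; apply/partition_vecP; split=> [i|i j ij].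
  rewrite /add_letter letter_wt_barred //; have := pos i.
  case: eqP => /= [ir|]; last by lia.
  have -> : i = r by apply: val_inj.
  have := pos (Ordinal sN); have := dec r (Ordinal sN) (leqnSn _).
  by move/eqP: mrs; lia.
rewrite /add_letter !letter_wt_barred //; have := dec i j ij.
case: (nat_of_ord i =P _) => [ir|]; last by lia.
case: (nat_of_ord j =P _) => [jr|jr] /=; first by lia.
have iO : i = r by apply: val_inj.
have := dec (Ordinal sN) j; have := dec r (Ordinal sN) (leqnSn _).
rewrite iO => h1 h2 _.
have {}h2 := h2 ltac:(rewrite /=; lia).
by move/eqP: mrs; lia.
Qed.

(** Both sides obey the same recursion, by induction on the number of letters still allowed: the
    terms that leave the partitions are discarded on the left and vanish on the right. *)
Lemma incr_gen_schur mu : is_partition_vec mu ->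
  incr_gen (fun nu => schur h nu) y 0 mu = tail_det 0 mu.
Proof.
suff H k nu : (k <= N + N)%N -> is_partition_vec nu ->
    incr_gen (fun nu => schur h nu) y (N + N - k) nu = tail_det (N + N - k) nu.
  by move=> mup; rewrite -(subnn (N + N)) H.
elim: k nu => [|k IH] nu kN nup; first by rewrite subn0 incr_gen_last tail_det_last.
have aN : (N + N - k.+1 < N + N)%N by lia.
have := incr_gen_rec (fun nu => schur h nu) y (Ordinal aN) nu.
have := tail_det_rec (Ordinal aN) nu.
have /= := @tail_det_vanish (Ordinal aN) nu nup.
have -> : ((N + N - k.+1).+1 = N + N - k)%N by lia.
move=> V -> ->; rewrite IH ?(ltnW kN) //; congr (_ + _).
case: ifP => [ap|/negbT /V ->]; last by rewrite mulr0.
by rewrite IH ?(ltnW kN).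
Qed.
End Transfer.
End Sums.

(** Lets scalar factors and the extraction of a coefficient pass through sums over runs. *)
Lemma incr_sum_linear (A R : comNzRingType) (q : A) (q' : R) (L : {additive A -> R})
    (g : ('I_N -> int) -> A) k mu p :
  (forall b x, L (q ^+ b * x) = q' ^+ b * L x) ->
  L (incr_sum q g k mu p) = incr_sum q' (fun nu => L (g nu)) k mu p.
Proof.
move=> Lq; elim: k mu p => [|k IH] mu p //=.
by rewrite raddf_sum; apply: eq_bigr => a _; rewrite Lq IH.
Qed.

End Words.

(** * The word sum as a coefficient of the solution *)

Section WordTheorem.
Variables (R : comNzRingType) (q : R) (D N : nat) (h : fps R).
Hypothesis q_nilp : q ^+ D.+1 = 0.
Hypothesis h0 : h.[:0] = 1.

Let qX : fps R := fps_const q.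
Let X : fps R := fps_var R.
Let Z := solution q D h.
(** With w the variable of h and z = [X] that of [Z], this is h(w) times the product of the 1 + q^k
    w z. [hKq] is its image under z -> qz, and the substitution w = z in hK(-w) yields the
    kernel. *)
Let hK : fps (fps R) := fps_map (@fps_const R) h * qprod qX D X.
Let hKq : fps (fps R) := fps_map (@fps_const R) h * qprod qX D (qX * X).

Let qX_nilp : qX ^+ D.+1 = 0.
Proof. by rewrite -rmorphXn /= q_nilp rmorph0. Qed.

Let hK_lin : hKq * lin (X * qX) = hK.
Proof. by rewrite /hK (qprod_shift qX_nilp X) /hKq [X * qX]mulrC; ring. Qed.

Let hK_ct : hK.[:0] = 1.
Proof. by rewrite fps_coefM0 qprod_ct mulr1 /= h0 rmorph1. Qed.

Let scale_hK : fps_map (fps_scale q) hK = hKq.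
Proof.
rewrite rmorphM /= map_qprod /= fps_scaleC fps_scaleX; congr (_ * _).
by apply: fpsP => n /=; rewrite fps_scaleC.
Qed.

Let diag_hK : fps_diag (fps_scale (-1) hK) = kernel q D h.
Proof.
rewrite rmorphM /= scale_qprod mulN1r rmorphM /= mulrC /kernel; congr (_ * _).
by rewrite -[in RHS](diag_map_const (fps_scale (-1) h)) fps_map_scale /= rmorphN1.
Qed.

Lemma coefM_Xsum (f : fps R) (F : nat -> fps R) M m : (m <= M)%N ->
  (f * \sum_(k < M.+1) fps_var R ^+ k * F k).[:m] =
  \sum_(k < m.+1) (f * F k).[:m - k].
Proof.
move=> mM; rewrite mulr_sumr fps_coef_sum.
under eq_bigr => k _ do rewrite mulrCA fps_coefXnM.
rewrite (big_ord_widen M.+1 (fun k => (f * F k).[:m - k])) //.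
rewrite [LHS](bigID (fun i : 'I__ => (i < m.+1)%N)) /= [X in _ + X]big1 ?addr0.
  by apply: eq_bigr => i; rewrite ltnS => ->.
by move=> i; rewrite -leqNgt => im; rewrite leqNgt im.
Qed.

Lemma coefM_Xn_small (f g : fps R) M m : (m < M)%N ->
  (f * (fps_var R ^+ M * g)).[:m] = 0.
Proof. by move=> mM; rewrite mulrCA fps_coefXnM leqNgt mM. Qed.

(** Induction on m, splitting off the first increasing run. Summed over its length, the runs
    contribute the Pieri factor 1/K(z), which turns Z(qz) into Z(z). The bound on l + m keeps all
    rows within the N available. *)
Theorem word_sum_schur m l (mu : 'I_N -> int) :
  is_partition_vec mu -> (forall i : 'I_N, (l <= i)%N -> mu i = 0) -> (l + m <= N)%N ->
  word_sum q (fun nu => schur h nu) m mu 0 = qfall q m m * (Z * schur hK mu).[:m].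
Proof.
elim/ltn_ind: m l mu => m IH l mu mup mul lm.
case: m => [|m] in IH lm *.
  (* At X = 0 the series [hK] becomes h. *)
  rewrite [word_sum _ _ _ _ _]/= /qfall big_ord0 mul1r fps_coefM0 solution_ct mul1r.
  rewrite -[RHS]/(ctcoef (schur hK mu)) -schur_map; congr schur.
  rewrite rmorphM /= map_qprod /qprod big1 ?mulr1.
    by apply: fpsP.
  by move=> k _; rewrite -[RHS](lin0 R); congr lin; apply: mulr0.
set M := m.+1 in IH lm *.
set T := Z * schur hK mu.
pose Zq := fps_scale q Z.
pose S k := incr_sum qX (fun nu => schur hKq nu) k mu 0.
(* The power q^(M-k) is absorbed by replacing X with qX before taking the coefficient of X^(M-k). *)
have step k : (0 < k)%N -> (k <= M)%N -> q ^+ (M - k) * qfall q M k *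
    incr_sum q (fun nu => word_sum q (fun nu => schur h nu) (M - k) nu 0) k mu 0 =
    qfall q M M * (Zq * S k).[:M - k].
  move=> k0 kM; rewrite /S.
  pose L (F : fps R) := (Zq * F).[:M - k].
  have LB : zmod_morphism L by move=> a b; rewrite /L mulrBr.
  pose La : {additive fps R -> R} := HB.pack L (GRing.isZmodMorphism.Build _ _ L LB).
  have -> : (Zq * incr_sum qX (fun nu => schur hKq nu) k mu 0).[:M - k] =
      incr_sum q (fun nu => L (schur hKq nu)) k mu 0.
    apply: (@incr_sum_linear _ _ _ qX q La) => b x.
    by rewrite /= /L -rmorphXn mulrCA fps_coefCM.
  rewrite (@eq_incr_sum _ _ q _ (fun nu =>
    qfall q (M - k) (M - k) * (Z * schur hK nu).[:M - k]) _ _ _ l) //; last first.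
    by move=> nu nup nul; apply: (IH _ _ (l + k)%N) => //; lia.
  rewrite -(qfall_split q kM).
  pose mulc (c x : R) := c * x.
  have mulcB a : zmod_morphism (mulc a) by move=> x y; rewrite /mulc mulrBr.
  pose add a : {additive R -> R} := HB.pack (mulc a) (GRing.isZmodMorphism.Build _ _ _ (mulcB a)).
  have scal a g : a * incr_sum q g k mu 0 = incr_sum q (fun nu => a * g nu) k mu 0.
    by apply: (@incr_sum_linear _ _ _ q q (add a)) => b x; rewrite /= /mulc mulrCA.
  rewrite !scal; congr incr_sum; apply: funext => nu.
  have -> : L (schur hKq nu) = q ^+ (M - k) * (Z * schur hK nu).[:M - k].
    by rewrite /L /Zq -scale_hK schur_map -rmorphM [LHS]fps_coef_scale.
  ring.
(* The run lengths are marked by y = X, the variable of [Z] itself, so the coefficients combine into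
   one of a product. *)
have total : \sum_(k < M.+1) (Zq * S k).[:M - k] = T.[:M].
  rewrite -(@coefM_Xsum _ S (N + N)); last by lia.
  rewrite -[X in Zq * X]/(incr_gen qX (fun nu => schur hKq nu) X 0 mu).
  rewrite (incr_gen_schur qX hKq X mup).
  rewrite tail_det_first.
  rewrite hK_lin.
  have [r ->] := @schur_pieri _ _ hK mu X l hK_ct ltac:(lia) mul.
  have [r' E] := diag_split (N - l) (fps_inv (fps_scale (-1) hK)).
  set A := \sum_(k < (N - l).+1) _ in E *.
  have -> : A = fps_diag (fps_inv (fps_scale (-1) hK)) - fps_var R ^+ (N - l).+1 * r'.
    by rewrite E addrK.
  set B := fps_diag _.
  have BK : B * kernel q D h = 1.
    by rewrite /B -diag_hK -[LHS](rmorphM (@fps_diag R)) mulrC fps_mulVr ?rmorph1 ?scale_ct.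
  (* Both remainders carry X^(N-l+1), which is invisible in degree M, at most N - l. *)
  have -> : Zq * ((B - fps_var R ^+ (N - l).+1 * r') * schur hK mu + X ^+ (N - l).+1 * r) =
    Zq * B * schur hK mu +
      Zq * (fps_var R ^+ (N - l).+1 * (r - r' * schur hK mu)) by rewrite /X; ring.
  rewrite fps_coefD coefM_Xn_small ?addr0; last by lia.
  congr (coef _ _); rewrite /T; congr (_ * _).
  by rewrite /Zq -(solution_eq q_nilp h0) -/Z mulrAC [kernel _ _ _ * B]mulrC BK mul1r.
rewrite -/M; set W := word_sum _ _ _ _ _.
(* The empty run k = 0 reproduces q^M W, to which the induction hypothesis does not apply; 1 - q^M
   is cancelled at the end. *)
have Wrec : W = q ^+ M * W + \sum_(k < M) q ^+ (M - k.+1) * qfall q M k.+1 *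
    incr_sum q (fun nu => word_sum q (fun nu => schur h nu) (M - k.+1) nu 0) k.+1 mu 0.
  rewrite {1}/W word_sum_incr big_ord_recl [qfall _ _ ord0]big_ord0 mulr1 subn0.
  by congr (_ + _).
have Wstep : \sum_(k < M) q ^+ (M - k.+1) * qfall q M k.+1 *
    incr_sum q (fun nu => word_sum q (fun nu => schur h nu) (M - k.+1) nu 0) k.+1 mu 0 =
    qfall q M M * \sum_(k < M) (Zq * S k.+1).[:M - k.+1].
  by rewrite mulr_sumr; apply: eq_bigr => k _; apply: step.
have {}total : (Zq * S 0%N).[:M] + \sum_(k < M) (Zq * S k.+1).[:M - k.+1] = T.[:M].
  by move: total; rewrite big_ord_recl subn0; apply.
have T0 : q ^+ M * T.[:M] = (Zq * S 0%N).[:M].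
  by rewrite /S [incr_sum _ _ _ _ _]/= /Zq -scale_hK schur_map -rmorphM [RHS]fps_coef_scale.
have alg (a w s1 f s2 c t : R) : w = a * w + s1 -> s1 = f * s2 -> c + s2 = t ->
    a * t = c -> (1 - a) * w = (1 - a) * (f * t).
  move=> h1 h2 h3 h4; rewrite mulrBl mul1r {1}h1 addrAC subrr add0r h2.
  by rewrite -(addKr c s2) h3 -h4; ring.
have E := alg _ _ _ _ _ _ _ Wrec Wstep total T0.
apply/eqP; rewrite -subr_eq0; apply/eqP.
apply: (@mulr_1Bq_eq0 _ q D q_nilp M) => //.
by rewrite mulrBr E subrr.
Qed.
End WordTheorem.

(** * Sums over raising operators *)

Section Peeling.
Variable n : nat.

Fact posp_first_proof (j : 'I_n) : ((ord0 : 'I_n.+1, lift ord0 j).1 < (ord0 : 'I_n.+1, lift ord0 j).2)%N.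
Proof. by []. Qed.

Fact posp_lift_proof (p : posp n) :
  ((lift ord0 (val p).1, lift ord0 (val p).2).1 < (lift ord0 (val p).1, lift ord0 (val p).2).2)%N.
Proof. by rewrite /= /bump /= ltn_add2l; case: p. Qed.

(** The pairs are sorted by whether they contain the first coordinate. *)
Definition posp_unpeel (x : 'I_n + posp n) : posp n.+1 :=
  match x with
  | inl j => exist _ (ord0, lift ord0 j) (posp_first_proof j)
  | inr p => exist _ (lift ord0 (val p).1, lift ord0 (val p).2) (posp_lift_proof p)
  end.

Arguments posp_unpeel : simpl never.

Lemma posp_unpeel_bij : bijective posp_unpeel.
Proof.
have inj : injective posp_unpeel.
  move=> [j|p] [j'|p'] /(congr1 val) E.
  - by have /lift_inj -> := congr1 snd E.
  - by have /eqP := congr1 fst E; rewrite eq_liftF.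
  - by have /eqP := congr1 fst E; rewrite eq_sym eq_liftF.
  - have /lift_inj h1 := congr1 fst E; have /lift_inj h2 := congr1 snd E.
    by congr inr; apply: val_inj; apply: injective_projections.
have surj p : exists x, posp_unpeel x == p.
  case: p => -[a b] /= ab.
  have [b' bE|bE] := unliftP ord0 b; last by move: ab; rewrite bE.
  have [a' aE|aE] := unliftP ord0 a.
    have ab' : ((a', b').1 < (a', b').2)%N.
      by move: ab; rewrite aE bE /= /bump /= ltn_add2l.
    by exists (inr (exist _ (a', b') ab')); rewrite -val_eqE /= aE bE.
  by exists (inl b'); rewrite -val_eqE /= aE bE.
exists (fun p => xchoose (surj p)) => [x|p]; last exact/eqP/(xchooseP (surj p)).
by apply: inj; apply/eqP/(xchooseP (surj _)).
Qed.

Lemma sum_posp_peel (V : nmodType) (G : posp n.+1 -> V) :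
  \sum_p G p = \sum_j G (posp_unpeel (inl j)) + \sum_p G (posp_unpeel (inr p)).
Proof.
rewrite (reindex posp_unpeel) /=; last exact/onW_bij/posp_unpeel_bij.
by rewrite big_sumType.
Qed.

Lemma sum_ffun_peel (V : nmodType) (J : finType) :
  exists glue : {ffun 'I_n -> J} -> {ffun posp n -> J} -> {ffun posp n.+1 -> J},
  [/\ forall A k j, glue A k (posp_unpeel (inl j)) = A j,
      forall A k p, glue A k (posp_unpeel (inr p)) = k p
    & forall G : {ffun posp n.+1 -> J} -> V, \sum_f G f = \sum_A \sum_k G (glue A k)].
Proof.
have [peel K1 K2] := posp_unpeel_bij.
pose glue (A : {ffun 'I_n -> J}) (k : {ffun posp n -> J}) :=
  [ffun p => match peel p with inl j => A j | inr p' => k p' end].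
exists glue; split=> [A k j|A k p|G]; rewrite ?ffunE ?K1 //.
rewrite pair_bigA (reindex (fun Ak => glue Ak.1 Ak.2)) //=.
apply: onW_bij; exists (fun f : {ffun posp n.+1 -> J} =>
  ([ffun j => f (posp_unpeel (inl j))], [ffun p => f (posp_unpeel (inr p))])).
  by case=> A k /=; congr pair; apply/ffunP => z; rewrite !ffunE K1.
move=> f; apply/ffunP => p; rewrite !ffunE -[in RHS](K2 p).
by case: (peel p) => z; rewrite ffunE.
Qed.
End Peeling.

Section RaisingSum.
Variables (R : comNzRingType) (q : R) (D : nat).

(* Raising operators q x_i/x_j and lowering operators q/(x_r x_s) applied to x^(1^n),
   with multiplicities at most D: nothing is lost when q^(D+1) = 0. *)
Definition raising_sum n (F : ('I_n -> int) -> R) : R :=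
  \sum_(k : {ffun posp n -> 'I_D.+1}) \sum_(m : {ffun posp n -> 'I_D.+1})
    q ^+ (\sum_p (k p + m p))%N * F (fun t => 1 + mon_wt k m t).

(** [A i] and [B i] are the multiplicities of x_1/x_(i+2) and 1/(x_1 x_(i+2)), for i counted from 0;
    the pairs that avoid x_1 form a raising sum in n variables. *)
Lemma raising_sum_peel n (F : ('I_n.+1 -> int) -> R) :
  raising_sum F =
  \sum_(A : {ffun 'I_n -> 'I_D.+1}) \sum_(B : {ffun 'I_n -> 'I_D.+1})
    q ^+ (\sum_i (A i + B i))%N *
    raising_sum (fun nu => F (fun t =>
      if unlift ord0 t is Some i then nu i - (A i)%:Z - (B i)%:Z
      else 1 + (\sum_i (A i : nat)%:Z) - (\sum_i (B i : nat)%:Z))).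
Proof.
rewrite /raising_sum; have [glue [g1 g2 sumE]] := sum_ffun_peel n R 'I_D.+1.
rewrite sumE; apply: eq_bigr => A _.
under eq_bigr => k _ do rewrite sumE.
rewrite exchange_big; apply: eq_bigr => B _.
rewrite big_distrr; apply: eq_bigr => k _.
rewrite big_distrr; apply: eq_bigr => m _ /=.
rewrite mulrA -exprD; congr (q ^+ _ * F _).
  rewrite sum_posp_peel; congr (_ + _)%N.
    by apply: eq_bigr => j _; rewrite !g1.
  by apply: eq_bigr => p _; rewrite !g2.
apply: funext => t; rewrite /mon_wt sum_posp_peel.
under [X in 1 + (X + _) = _]eq_bigr => j _ do rewrite !g1 /=.
under [X in 1 + (_ + X) = _]eq_bigr => p _ do rewrite !g2 /=.
case: unliftP => [i|] ->.
  rewrite [X in 1 + (X + _) = _](_ : _ = - (A i)%:Z - (B i)%:Z); last first.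
    rewrite (bigD1 i) //= !(inj_eq (@lift_inj _ ord0)) eqxx big1.
      by rewrite addr0 /=; lia.
    by move=> j /negPf ji; rewrite !(inj_eq (@lift_inj _ ord0)) [i == j]eq_sym ji /=; lia.
  rewrite [X in 1 + (_ + X) = _](_ : _ = \sum_(p : posp n)
     ((k p : nat)%:Z * ((i == (val p).1)%:Z - (i == (val p).2)%:Z)
      - (m p : nat)%:Z * ((i == (val p).1)%:Z + (i == (val p).2)%:Z))); first by ring.
  by apply: eq_bigr => p _; rewrite !(inj_eq (@lift_inj _ ord0)).
rewrite [X in 1 + (_ + X) = _]big1 ?addr0.
  rewrite -addrA -sumrB; congr (_ + _); apply: eq_bigr => j _.
  by rewrite /=; lia.
by move=> p _; rewrite /=; lia.
Qed.
End RaisingSum.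

Section KernelCoefficients.
Variables (R : comNzRingType) (q : R) (D : nat).
Hypothesis q_nilp : q ^+ D.+1 = 0.
Implicit Types h : fps R.

Let kappa b := (qprod q D 1).[:b].

(* The coefficient of w z^m in (1 + z/w)^-1 prod_(k >= 1) (1 + z q^k w) sum_j h_j w^j. *)
Definition bernstein_coef h m : R :=
  \sum_(b < m.+1) (-1) ^+ (m - b) * kappa b * hz h (1 + (m - b)%N%:Z - b%:Z).

(** Both sides are signed sums over b of kappa_b h_(m+1-2b). *)
Lemma coef_kernelS h m : (kernel q D h).[:m.+1] = - bernstein_coef h m.
Proof.
have sgn (i j : nat) : odd i = odd j -> (-1) ^+ i = (-1) ^+ j :> R.
  by move=> ij; rewrite -signr_odd ij signr_odd.
rewrite fps_coefM.
pose F i b := if i == (b + b)%N then (-1) ^+ b * kappa b * (fps_scale (-1) h).[:m.+1 - i] else 0.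
transitivity (\sum_(i < m.+2) \sum_(b < m.+2) F i b).
  apply: eq_bigr => i _; rewrite coef_qpair big_distrl /=.
  rewrite (big_ord_widen m.+2 (fun b => (if i == (b + b)%N :> nat then (-1) ^+ b * kappa b else 0) *
    ((-1) ^+ (m.+1 - i) * h.[:m.+1 - i]))) //.
  rewrite [RHS](bigID (fun b : 'I__ => (b < i.+1)%N)) /= [X in _ = _ + X]big1 ?addr0.
    by apply: eq_bigr => b _; rewrite /F; case: eqP => // _; rewrite mul0r.
  by move=> b bi; rewrite /F; case: eqP => //; lia.
(* The last value b = m+1 would need i = 2m+2, beyond the range of i. *)
rewrite exchange_big big_ord_recr /= [X in _ + X]big1 ?addr0; last first.
  by move=> i _; rewrite /F; case: eqP => //; have := ltn_ord i; lia.
rewrite -sumrN; apply: eq_bigr => b _.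
case: (leqP (b + b) m.+1) => bm.
  rewrite (bigD1 (Ordinal (bm : (b + b < m.+2)%N))) //= big1 ?addr0; last first.
    by move=> i; rewrite -val_eqE /= /F => /negPf ->.
  rewrite /F eqxx /=.
  have -> : 1 + (m - b)%N%:Z - b%:Z = (m.+1 - (b + b))%N%:Z by have := ltn_ord b; lia.
  rewrite /= mulrA -!mulNr; congr (_ * _).
  rewrite mulrAC -exprD; congr (_ * _).
  by rewrite -[RHS]mulN1r -exprS; apply: sgn; have := ltn_ord b; lia.
rewrite big1 => [|i _]; last by rewrite /F; case: eqP => //; have := ltn_ord i; lia.
by rewrite hz_neg ?mulr0 ?oppr0 //; have := ltn_ord b; lia.
Qed.

(** The functional equation in degree n+1, with the contribution of the constant term of the kernel
    moved to the other side. *)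
Lemma solution_bernstein h n : h.[:0] = 1 ->
  \sum_(i < n.+1) (solution q D h).[:i] * bernstein_coef h (n - i) =
  (1 - q ^+ n.+1) * (solution q D h).[:n.+1].
Proof.
move=> h0; set Z := solution q D h.
have E : (kernel q D h * Z).[:n.+1] = (fps_scale q Z).[:n.+1] by rewrite solution_eq.
move: E; rewrite mulrC [RHS]fps_coef_scale fps_coefM big_ord_recr subnn kernel_ct // mulr1 => E.
rewrite mulrBl mul1r -E opprD addrA addrC addrA addNr add0r -sumrN.
apply: eq_bigr => i _; have -> : (n.+1 - widen_ord (leqnSn n.+1) i = (n - i).+1)%N.
  by rewrite [nat_of_ord _]/= subSn ?leq_ord.
rewrite coef_kernelS.
by rewrite mulrN opprK.
Qed.
End KernelCoefficients.

Section RaisingStep.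
Variables (R : comNzRingType) (q : R) (D n : nat) (h : fps R).
Hypothesis q_nilp : q ^+ D.+1 = 0.
Hypothesis h0 : h.[:0] = 1.

Let R1 : comNzRingType := fps R.
Let R2 : comNzRingType := fps R1.
Let iota : {rmorphism R -> R2} := (@fps_const R1) \o (@fps_const R).
Let y : R2 := fps_var R1.
Let x : R2 := @fps_const R1 (fps_var R).
Let q2 : R2 := iota q.

Let q2_nilp : q2 ^+ D.+1 = 0.
Proof. by rewrite -rmorphXn q_nilp rmorph0. Qed.

(** Here y stands for 1/w and x for w, kept as independent variables so that no Laurent series
    arise. The factors realise E*(-1/w), H*(q/w) and H*(qw). *)
Definition bernstein_series : fps R2 :=
  fps_map iota h * lin (- y) * geo (q2 * y) * geo (q2 * x).

Let h' := bernstein_series.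

Lemma bernstein_series_ct : h'.[:0] = 1.
Proof. by rewrite !fps_coefM0 lin_ct /= h0 rmorph1 !mulr1. Qed.

Let qprod_iota : fps_map iota (qprod q D 1) = qprod q2 D 1.
Proof. by rewrite map_qprod rmorph1. Qed.

Let qpair_iota : qpair q2 D = fps_map iota (qpair q D).
Proof.
apply: fpsP => m; rewrite coef_qpair -[RHS]/(iota (qpair q D).[:m]) coef_qpair rmorph_sum.
apply: eq_bigr => b _; case: ifP => _; last by rewrite rmorph0.
by rewrite -qprod_iota rmorphM rmorphXn rmorphN1.
Qed.

(** By uniqueness: the kernel is multiplied by (1 + yz) / ((1 + qyz)(1 + qxz)), the ratio of the new
    factor at qz to its value at z. *)
Lemma solution_bernstein_series :
  solution q2 D h' = fps_map iota (solution q D h) * (geo (- y) * qprod q2 D x).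
Proof.
apply/esym/solution_uniq => //; first exact: bernstein_series_ct.
  by rewrite !fps_coefM0 qprod_ct /= solution_ct rmorph1 !mulr1.
have E : fps_map iota (kernel q D h) * fps_map iota (solution q D h) =
    fps_scale q2 (fps_map iota (solution q D h)).
  by rewrite -rmorphM solution_eq //=; apply: fps_map_scale.
have K : kernel q2 D h' = fps_map iota (kernel q D h) *
    (lin y * geo (- (q2 * y)) * geo (- (q2 * x))).
  rewrite /kernel /h' /bernstein_series qpair_iota !rmorphM /= fps_map_scale rmorphN1.
  by rewrite scale_lin !scale_geo !mulN1r opprK; ring.
have ly := lin_geo (- y); rewrite opprK in ly.
have lx := lin_geo (- (q2 * x)); rewrite opprK in lx.
rewrite K [RHS]rmorphM [X in _ = _ * X]rmorphM /= -E scale_geo scale_qprod.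
rewrite (qprod_shift q2_nilp x) mulrN.
set a := fps_map iota _ in ly lx *; set b := fps_map iota _ in ly lx *.
transitivity (a * b * (lin y * geo (- y)) * geo (- (q2 * y)) *
  (lin (q2 * x) * geo (- (q2 * x))) * qprod q2 D (q2 * x)); first by ring.
by rewrite ly lx; ring.
Qed.

Variable S : nat.

(* The functional y^s x^b |-> h_(1+s-b): it reads off the first row. *)
Definition first_row (F : R2) : R :=
  \sum_(s < S) \sum_(b < S) hz h (1 + s%:Z - b%:Z) * F.[:s].[:b].

Fact first_row_zmod : zmod_morphism first_row.
Proof.
move=> F G; rewrite /first_row -sumrB; apply: eq_bigr => s _.
by rewrite -sumrB; apply: eq_bigr => b _; rewrite -mulrBr.
Qed.
HB.instance Definition _ := GRing.isZmodMorphism.Build R2 R first_row first_row_zmod.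

Lemma first_rowC r F : first_row (iota r * F) = r * first_row F.
Proof.
rewrite /first_row mulr_sumr; apply: eq_bigr => s _.
rewrite mulr_sumr; apply: eq_bigr => b _.
by rewrite mulrCA; congr (_ * _); rewrite fps_coefCM [LHS]fps_coefCM.
Qed.

Lemma first_row_monomial s b : (s < S)%N -> (b < S)%N ->
  first_row (y ^+ s * x ^+ b) = hz h (1 + s%:Z - b%:Z).
Proof.
move=> sS bS.
have E s' b' : (y ^+ s * x ^+ b).[:s'].[:b'] = ((s' == s) && (b' == b))%:R.
  rewrite fps_coefXnM; case: leqP => ss; last first.
    by rewrite fps_coef0 (_ : (s' == s) = false) //; lia.
  have -> : x ^+ b = fps_const (fps_var R ^+ b) by rewrite /x rmorphXn.
  case: (s' =P s) => [->|ne]; last first.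
    by case E: (s' - s)%N => [|k]; [lia | rewrite fps_coef0].
  rewrite subnn -[_.[:0]]/(fps_var R ^+ b) -[_ ^+ b]mulr1 fps_coefXnM fps_coef1.
  case: leqP => bb; last by rewrite (_ : (b' == b) = false) //; lia.
  by rewrite (_ : (b' - b == 0)%N = (b' == b)) //; lia.
rewrite /first_row (bigD1 (Ordinal sS)) // -[RHS]addr0; congr (_ + _); last first.
  apply: big1 => s' H; apply: big1 => b' _; rewrite E.
  by move: H; rewrite -val_eqE /= => /negPf ->; rewrite mulr0.
rewrite (bigD1 (Ordinal bS)) // -[RHS]addr0; congr (_ + _); last first.
  by apply: big1 => b' H; rewrite E; move: H; rewrite -val_eqE /= => /negPf ->; rewrite andbF mulr0.
by rewrite E !eqxx mulr1.
Qed.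

Lemma first_row_solution m : (m < S)%N ->
  first_row (geo (- y) * qprod q2 D x).[:m] = bernstein_coef q D h m.
Proof.
move=> mS; rewrite mulrC fps_coefM raddf_sum; apply: eq_bigr => b _ /=.
have bm := ltn_ord b.
rewrite [in LHS]coef_qprod -qprod_iota.
have -> : x ^+ b * (fps_map iota (qprod q D 1)).[:b] * (- y) ^+ (m - b) =
    iota ((-1) ^+ (m - b) * (qprod q D 1).[:b]) * (y ^+ (m - b) * x ^+ b).
  rewrite -[- y]mulN1r exprMn rmorphM rmorphXn rmorphN1 /=; ring.
by rewrite first_rowC first_row_monomial //; lia.
Qed.

Let geo_small c k : (D < k)%N -> (geo (q2 * c)).[:k] = 0.
Proof.
by move=> Dk; rewrite /= exprMn -(subnKC Dk) exprD q2_nilp !mul0r.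
Qed.

(** The two geometric factors expand over B and A, and 1 - yz over the minors j. The monomial
    y^(|A|+j) x^|B| is read as h_(1+|A|-|B|+j), which rebuilds the expansion of a determinant with
    n+1 rows along its first row. *)
Lemma first_row_schur (nu : 'I_n -> int) : (n * D + n < S)%N ->
  first_row (schur h' nu) =
  \sum_(A : {ffun 'I_n -> 'I_D.+1}) \sum_(B : {ffun 'I_n -> 'I_D.+1})
    q ^+ (\sum_i (A i + B i))%N * schur h (fun t : 'I_n.+1 =>
      if unlift ord0 t is Some i then nu i - (A i)%:Z - (B i)%:Z
      else 1 + (\sum_i (A i : nat)%:Z) - (\sum_i (B i : nat)%:Z)).
Proof.
move=> nS.
have bound (A : {ffun 'I_n -> 'I_D.+1}) : (\sum_i (A i : nat) <= n * D)%N.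
  rewrite -[X in (_ <= X)%N](_ : \sum_(i < n) D = n * D)%N; last first.
    by rewrite sum_nat_const card_ord.
  by apply: leq_sum => i _; rewrite -ltnS.
have prodE c (A : {ffun 'I_n -> 'I_D.+1}) :
    \prod_i (geo (q2 * c)).[:A i] = (q2 * c) ^+ (\sum_i (A i : nat)).
  exact: prodrXr.
rewrite /h' /bernstein_series (schur_mul _ _ (@geo_small x)) raddf_sum [RHS]exchange_big.
apply: eq_bigr => B _; rewrite (schur_mul _ _ (@geo_small y)) mulr_sumr raddf_sum.
apply: eq_bigr => A _; rewrite schur_recl [RHS]mulr_sumr !prodE schur_minorE [in LHS]mulr_sumr [in LHS]mulr_sumr raddf_sum.
apply: eq_bigr => j _; rewrite schur_minor_map unlift_none.
set M := schur_minor h _ j; set M' := schur_minor h _ j.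
have -> : M' = M.
  congr (\det _); apply/matrixP => i c; rewrite !mxE liftK; congr hz.
  by rewrite /=; lia.
have aD := bound A; have bD := bound B; have jn := ltn_ord j.
rewrite -!(big_morph Posz PoszD (erefl _)) big_split /=.
set a := (\sum_i (A i : nat))%N in aD *; set b := (\sum_i (B i : nat))%N in bD *.
transitivity (first_row (iota (q ^+ (a + b) * (-1) ^+ j * M) * (y ^+ (a + j) * x ^+ b))).
  congr first_row; rewrite !rmorphM !rmorphXn rmorphN1 -[in LHS](mulN1r y) !exprMn !exprD.
  by rewrite -[iota q]/q2; ring.
rewrite first_rowC first_row_monomial; [|lia|lia].
rewrite -!mulrA; congr (_ * (_ * _)); rewrite mulrC; congr (hz _ _ * _).
by rewrite PoszD; ring.
Qed.
End RaisingStep.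

Lemma exchange_big4 (V : nmodType) (I J K L : finType) (F : I -> J -> K -> L -> V) :
  \sum_i \sum_j \sum_k \sum_l F i j k l = \sum_k \sum_l \sum_i \sum_j F i j k l.
Proof.
under eq_bigr => i _ do rewrite exchange_big.
rewrite exchange_big; apply: eq_bigr => k _.
under eq_bigr => i _ do rewrite exchange_big.
by rewrite exchange_big.
Qed.

(** Induction on n over all coefficient rings at once: the first row is peeled off, and the
    hypothesis is applied over the double series ring to [bernstein_series], whose solution differs
    by a scalar factor. *)
Theorem raising_sum_schur (R : comNzRingType) (q : R) (D n : nat) (h : fps R) :
  q ^+ D.+1 = 0 -> h.[:0] = 1 ->
  raising_sum q D (fun a : 'I_n -> int => schur h a) =
  qfall q n n * (solution q D h).[:n].
Proof.
elim: n R q h => [|n IH] R q h q_nilp h0.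
  rewrite /qfall big_ord0 mul1r solution_ct /raising_sum.
  have one (J : finType) (x : {ffun posp 0 -> J}) (F : {ffun posp 0 -> J} -> R) :
      \sum_f F f = F x.
    by apply: big_pred1 => f; apply/esym/eqP/ffunP => -[[[]]].
  by rewrite !(one _ [ffun=> ord0]) big1 => [|[[[]]]//]; rewrite mul1r [schur _ _]det_mx00.
pose R2 : comNzRingType := fps (fps R).
pose iota : {rmorphism R -> R2} := (@fps_const (fps R)) \o (@fps_const R).
(* Exceeds all exponents: the sums of A and of B are at most n*D, and the column index is at most
   n. *)
pose S := (n * D + n).+1.
have q2_nilp : iota q ^+ D.+1 = 0 by rewrite -rmorphXn q_nilp rmorph0.
have frC r G : first_row h S (iota r * G) = r * first_row h S G by exact: first_rowC.
transitivity (first_row h S (raising_sum (iota q) D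
    (fun a : 'I_n -> int => schur (bernstein_series q h) a))).
  rewrite raising_sum_peel /raising_sum.
  pose F (A B : {ffun 'I_n -> 'I_D.+1}) (k m : {ffun posp n -> 'I_D.+1}) : R := q ^+ (\sum_i (A i + B i))%N *
    (q ^+ (\sum_p (k p + m p))%N * schur h (fun t : 'I_n.+1 =>
      if unlift ord0 t is Some i then 1 + mon_wt k m i - (A i)%:Z - (B i)%:Z
      else 1 + (\sum_i (A i : nat)%:Z) - (\sum_i (B i : nat)%:Z))).
  transitivity (\sum_A \sum_B \sum_k \sum_m F A B k m).
    apply: eq_bigr => A _; apply: eq_bigr => B _.
    by rewrite mulr_sumr; apply: eq_bigr => k _; rewrite mulr_sumr.
  rewrite exchange_big4 raddf_sum; apply: eq_bigr => k _.
  rewrite raddf_sum; apply: eq_bigr => m _.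
  transitivity (q ^+ (\sum_p (k p + m p))%N *
    first_row h S (schur (bernstein_series q h) (fun t : 'I_n => 1 + mon_wt k m t))).
    rewrite (first_row_schur h q_nilp) // mulr_sumr; apply: eq_bigr => A _.
    by rewrite mulr_sumr; apply: eq_bigr => B _; exact: mulrCA.
  by rewrite -frC rmorphXn.
rewrite IH //; last exact: bernstein_series_ct.
rewrite solution_bernstein_series //.
have -> : qfall (iota q) n n = iota (qfall q n n).
  by rewrite rmorph_prod; apply: eq_bigr => i _; rewrite rmorphB rmorph1 rmorphXn.
(* Reading the first row of the scalar factor gives the Bernstein coefficients, whose convolution
   with Z supplies the missing 1 - q^(n+1). *)
rewrite frC fps_coefM raddf_sum qfallS [RHS]mulrAC -(solution_bernstein q_nilp) //.
rewrite [RHS]mulrC; congr (_ * _); apply: eq_bigr => i _.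
rewrite -(@first_row_solution _ q D h S); last by rewrite /S; lia.
exact: frC.
Qed.

(** * Words and alternants *)

Lemma raising_sum_word_sum (R : comNzRingType) (q : R) (D n : nat) (h : fps R) :
  q ^+ D.+1 = 0 -> h.[:0] = 1 ->
  raising_sum q D (fun a : 'I_n -> int => schur h a) =
  word_sum q (fun a => schur h a) n (fun _ : 'I_n => 0) 0.
Proof.
move=> qD h0; rewrite raising_sum_schur // (@word_sum_schur _ _ D _ _ qD h0 n 0) //.
  rewrite schur_zero ?mulr1 // fps_coefM0 qprod_ct mulr1 [_.[:0]]/= h0; exact: rmorph1.
by apply/partition_vecP.
Qed.

Section WordExpansion.
Variable N : nat.
Notation letter := 'I_(N + N).

Definition word_wt m (b : {ffun 'I_m -> letter}) (t : 'I_N) : int :=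
  \sum_(j < m) letter_wt (b j) t.

Definition prefix_wt m (b : {ffun 'I_m -> letter}) (i : 'I_m) (t : 'I_N) : int :=
  \sum_(j < m | (j <= i)%N) letter_wt (b j) t.

Definition word_ok mu m (b : {ffun 'I_m -> letter}) :=
  [forall i, is_partition_vec (fun t => mu t + prefix_wt b i t)].

Definition word_seq m (b : {ffun 'I_m -> letter}) := [seq (b i : nat) | i <- enum 'I_m].

(** Follows the recursion of [word_sum]: p is the previous letter plus one, so [a < p] means a weak
    descent. *)
Fixpoint seq_energy p (s : seq nat) : nat :=
  if s is a :: s' then (size s * (a < p) + seq_energy a.+1 s')%N else 0%N.

Definition word_cons m (a : letter) (b : {ffun 'I_m -> letter}) : {ffun 'I_m.+1 -> letter} :=
  [ffun i => if unlift ord0 i is Some j then b j else a].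

Lemma word_cons0 m a (b : {ffun 'I_m -> letter}) : word_cons a b ord0 = a.
Proof. by rewrite ffunE unlift_none. Qed.

Lemma word_consS m a (b : {ffun 'I_m -> letter}) i : word_cons a b (lift ord0 i) = b i.
Proof. by rewrite ffunE liftK. Qed.

Lemma sum_word_cons (V : nmodType) m (P : pred {ffun 'I_m.+1 -> letter})
    (G : {ffun 'I_m.+1 -> letter} -> V) :
  \sum_(b | P b) G b = \sum_a \sum_(b | P (word_cons a b)) G (word_cons a b).
Proof.
rewrite pair_big_dep /= (reindex (fun ab => word_cons ab.1 ab.2)) //=.
apply: onW_bij; exists (fun b : {ffun 'I_m.+1 -> letter} => (b ord0, [ffun j => b (lift ord0 j)])).
  case=> a b; congr pair; first exact: word_cons0.
  by apply/ffunP => j; rewrite ffunE word_consS.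
move=> b; apply/ffunP => i; rewrite ffunE /=.
by case: unliftP => [j|] ->; rewrite ?ffunE.
Qed.

Lemma word_seq_cons m a (b : {ffun 'I_m -> letter}) :
  word_seq (word_cons a b) = (a : nat) :: word_seq b.
Proof.
rewrite /word_seq enum_ordSl /= word_cons0 -map_comp; congr cons.
by apply: eq_map => i /=; rewrite word_consS.
Qed.

Lemma size_word_seq m (b : {ffun 'I_m -> letter}) : size (word_seq b) = m.
Proof. by rewrite size_map size_enum_ord. Qed.

Lemma word_ok_cons mu m a (b : {ffun 'I_m -> letter}) :
  word_ok mu (word_cons a b) =
  is_partition_vec (add_letter a mu) && word_ok (add_letter a mu) b.
Proof.
have E0 : (fun t => mu t + prefix_wt (word_cons a b) ord0 t) = add_letter a mu.
  apply: funext => t; rewrite /prefix_wt big_mkcond big_ord_recl /= word_cons0.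
  by rewrite big1 ?addr0.
have ES i : (fun t => mu t + prefix_wt (word_cons a b) (lift ord0 i) t) =
    (fun t => add_letter a mu t + prefix_wt b i t).
  apply: funext => t; rewrite /prefix_wt big_mkcond big_ord_recl /= word_cons0 addrA.
  congr (_ + _); rewrite [RHS]big_mkcond; apply: eq_bigr => j _.
  by rewrite word_consS.
apply/forallP/andP => [H|[H0 /forallP H] i].
  split; first by rewrite -E0; apply: H.
  by apply/forallP => i; rewrite -ES; apply: H.
by case: (unliftP ord0 i) => [j|] ->; rewrite ?ES ?E0.
Qed.

Lemma word_sum_expand (R : comNzRingType) (q : R) g m mu p :
  word_sum q g m mu p =
  \sum_(b : {ffun 'I_m -> letter} | word_ok mu b)
    q ^+ (seq_energy p (word_seq b) + \sum_i (N <= b i)) * g (fun t => mu t + word_wt b t).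
Proof.
elim: m mu p => [|m IH] mu p /=.
  pose b0 : {ffun 'I_0 -> letter} := [ffun i : 'I_0 => match notF (ltn_ord i) with end].
  rewrite (big_pred1 b0) => [|b]; last first.
    by rewrite /= (_ : b = b0) ?eqxx; [apply/forallP => -[] | apply/ffunP => -[]].
  rewrite /word_seq big_ord0 (_ : enum 'I_0 = [::]) /=; last by apply/size0nil; rewrite size_enum_ord.
  by rewrite mul1r; congr g; apply: funext => t; rewrite /word_wt big_ord0 addr0.
rewrite sum_word_cons big_mkcond; apply: eq_bigr => a _.
case: ifP => ap; last first.
  by rewrite big_pred0 // => b; rewrite word_ok_cons ap.
rewrite IH mulr_sumr; apply: eq_big => [b|b _]; first by rewrite word_ok_cons ap.
rewrite mulrA -exprD word_seq_cons /= size_word_seq big_ord_recl word_cons0.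
under [in RHS]eq_bigr => i _ do rewrite word_consS.
congr (q ^+ _ * g _); first by rewrite addnACA.
apply: funext => t; rewrite /word_wt big_ord_recl word_cons0 addrA; congr (_ + _).
by apply: eq_bigr => i _; rewrite word_consS.
Qed.

Lemma seq_energyE p s : seq_energy p s = (size s * (nth 0 s 0 < p) +
  \sum_(0 <= j < (size s).-1) (size s - j.+1) * (nth 0 s j.+1 <= nth 0 s j))%N.
Proof.
elim: s p => [|a s IH] p; first by rewrite /= big_geq.
rewrite /= IH; case: s {IH} => [|c s] /=; first by rewrite !big_geq.
by rewrite [in RHS]big_nat_recl //= subSS subn0.
Qed.
End WordExpansion.

Lemma energyE n (b : {ffun 'I_n -> 'I_(n + n)}) : energy b = seq_energy 0 (word_seq b).
Proof. by rewrite seq_energyE size_word_seq ltn0 muln0 add0n. Qed.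

(** The Vandermonde determinant in the values of s is that of the identity times the sign of s; as a
    product of differences, it has one negative factor for each inversion. *)
Lemma sign_inversions n (s : 'S_n) : (-1) ^+ inversions s = (-1) ^+ s :> int.
Proof.
pose v (u : 'S_n) : 'rV[int]_n := \row_i (u i : nat)%:Z.
have detV (u : 'S_n) : \det (Vandermonde n (v u)) =
    (-1) ^+ u * \det (Vandermonde n (v 1%g)).
  rewrite -odd_permV -det_perm mulrC -det_mulmx -col_permE; congr (\det _).
  by apply/matrixP => i j; rewrite !mxE perm1.
have sgV (u : 'S_n) : Num.sg (\det (Vandermonde n (v u))) = (-1) ^+ inversions u.
  rewrite det_Vandermonde (big_morph _ (@sgrM _) (@sgr1 _)).
  under eq_bigr => i _ do rewrite (big_morph _ (@sgrM _) (@sgr1 _)).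
  rewrite pair_big_dep /=.
  transitivity (\prod_(p : 'I_n * 'I_n | (p.1 < p.2)%N) (-1 : int) ^+ (u p.2 < u p.1)%N).
    apply: eq_bigr => -[i j] /= ij; rewrite !mxE.
    have uij : u i != u j :> nat by apply/eqP => /val_inj /perm_inj E; rewrite E ltnn in ij.
    case: ltnP => h; first by rewrite ltr0_sg //; lia.
    by rewrite gtr0_sg //; lia.
  rewrite prodrXr; congr (_ ^+ _); rewrite /inversions -sum1_card.
  rewrite [RHS](eq_bigl (fun p : 'I_n * 'I_n => (p.1 < p.2)%N && (u p.2 < u p.1)%N)); last first.
    by move=> p; rewrite inE.
  by rewrite big_mkcondr; apply: eq_bigr => p _; case: ltnP.
have inv1 : inversions (1 : 'S_n) = 0%N.
  by apply/eqP; rewrite cards_eq0; apply/eqP/setP => p; rewrite !inE !perm1; lia.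
by rewrite -sgV detV sgrM sgV inv1 mulr1 sgrX sgrN1.
Qed.

(** * Alternants and the bialternant formula *)

Section Alternants.
Variables (A : comNzRingType) (n : nat) (x : 'I_n -> A).

Definition complete : fps A := \prod_i geo (x i).

(** The entry is the power of x_k with exponent m_i, read as 0 when the exponent is negative. *)
Definition alternant (m : 'I_n -> int) : A :=
  \det (\matrix_(i < n, k < n) hz (geo (x k)) (m i)).

Definition staircase (i : 'I_n) : int := (n - i.+1)%N%:Z.

Lemma complete_ct : complete.[:0] = 1.
Proof. by rewrite -[LHS]/(ctcoef complete) rmorph_prod big1. Qed.

Lemma coef_prod_lin (I : Type) (s : seq I) (c : I -> A) k : (size s < k)%N ->
  (\prod_(i <- s) lin (c i)).[:k] = 0.
Proof.
elim: s k => [|i s IH] k sk; first by rewrite big_nil fps_coef1; case: k sk.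
rewrite big_cons mulrDl mul1r fps_coefD -mulrA fps_coefCM fps_coefXM IH; last exact: ltnW.
case: k sk => // k sk; rewrite IH ?mulr0 ?addr0 //.
Qed.

(** Multiplying the complete series by all 1 - x_l z with l != k leaves 1/(1 - x_k z). Hence the
    Jacobi-Trudi matrix times the matrix [C] of coefficients of these products is the matrix of
    powers. *)
Lemma schur_alternant (a : 'I_n -> int) :
  schur complete a * alternant staircase = alternant (fun i => a i + staircase i).
Proof.
pose p (k : 'I_n) := \prod_(l <- [seq l <- index_enum 'I_n | l != k]) lin (- x l).
pose C : 'M[A]_n := \matrix_(j, k) (p k).[:n - j.+1].
have pE k : complete * p k = geo (x k).
  rewrite /complete (bigD1 k) //= /p big_filter -mulrA -big_split /=.
  by rewrite big1 ?mulr1 // => l _; rewrite mulrC lin_geo.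
have HC (b : 'I_n -> int) : schur complete b * \det C = alternant (fun i => b i + staircase i).
  rewrite -det_mulmx; congr (\det _); apply/matrixP => i k; rewrite !mxE -pE.
  have n0 : (0 < n)%N by apply: leq_ltn_trans (ltn_ord i).
  rewrite (@hz_mul _ n.-1) => [|j nj]; last first.
    apply: coef_prod_lin; rewrite size_filter -sum1_count sum1_card.
    by rewrite cardC1 card_ord.
  rewrite prednK // [RHS](reindex_inj (@rev_ord_inj n)) /=.
  apply: eq_bigr => j _; rewrite !mxE mulrC; congr (_ * hz _ _).
  by rewrite /staircase; have := ltn_ord j; have := ltn_ord i; lia.
(* The case a = 0 identifies det C with the Vandermonde determinant. *)
rewrite -HC; congr (_ * _).
have := HC (fun _ => 0); rewrite schur_zero ?complete_ct // mul1r => ->.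
by congr (\det _); apply/matrixP => i k; rewrite !mxE add0r.
Qed.
End Alternants.

(** * Reading off coefficients *)

Lemma in_qpoly_Xn_coef (A : comNzRingType) d (P Q : {poly A}) :
  in_qpoly 'X^(d.+1) P = in_qpoly 'X^(d.+1) Q -> P`_d = Q`_d.
Proof.
move/(congr1 (fun p : {poly %/ 'X^(d.+1)} => (p : {poly A}))) => /=; rewrite mk_monic_Xn /= => PQ.
have E (S : {poly A}) : S`_d = (Pdiv.CommonRing.rmodp S 'X^(d.+1))`_d.
  by rewrite {1}(Pdiv.RingMonic.rdivp_eq (monicXn A d.+1) S) coefD coefMXn ltnSn add0r.
by rewrite E PQ -E.
Qed.

Lemma coef_XnC (A : comNzRingType) e d (c : A) :
  ('X^e * c%:P)`_d = if e == d then c else 0.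
Proof.
rewrite coefXnM coefC; case: ltnP => ed; first by rewrite (gtn_eqF ed).
by rewrite subn_eq0 eqn_leq ed.
Qed.

(** The identity is taken in A[X]/(X^(d+1)) with q the class of X, multiplied by the Vandermonde
    determinant, and read in degree d. *)
Lemma raising_alternant_eq (A : comNzRingType) n (x : 'I_n -> A) d :
  \sum_(k : {ffun posp n -> 'I_d.+1}) \sum_(m : {ffun posp n -> 'I_d.+1})
    (if (\sum_p (k p + m p))%N == d then
       alternant x (fun i => 1 + mon_wt k m i + staircase i) else 0) =
  \sum_(b : {ffun 'I_n -> 'I_(n + n)} | word_ok (fun=> 0) b)
    (if (energy b + \sum_i (n <= b i))%N == d then
       alternant x (fun i => word_wt b i + staircase i) else 0).
Proof.
pose psi : {rmorphism {poly A} -> {poly %/ ('X^(d.+1) : {poly A})}} := in_qpoly 'X^(d.+1).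
pose phi : {rmorphism A -> {poly %/ ('X^(d.+1) : {poly A})}} := psi \o polyC.
pose V := alternant x (@staircase n).
pose h := fps_map phi (complete x).
have h0 : h.[:0] = 1 by rewrite -[LHS]/(phi (complete x).[:0]) complete_ct rmorph1.
have q0 : psi 'X ^+ d.+1 = 0.
  rewrite -rmorphXn; apply/val_inj => /=; rewrite mk_monic_Xn /=.
  exact: (Pdiv.RingMonic.rmodpp (monicXn A d.+1)).
have phiE e a : psi 'X ^+ e * schur h a * phi V =
    psi ('X^e * (alternant x (fun i : 'I_n => a i + staircase i))%:P).
  rewrite schur_map -mulrA -rmorphM schur_alternant rmorphM rmorphXn.
  by [].
have := raising_sum_word_sum n q0 h0.
rewrite word_sum_expand => /(congr1 (fun z => z * phi V)).
rewrite /raising_sum !big_distrl /=.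
under eq_bigr => k _ do [rewrite big_distrl /=; under eq_bigr => m _ do rewrite phiE].
under [in RHS]eq_bigr => b _ do rewrite phiE.
under eq_bigr => k _ do rewrite -(raddf_sum psi).
rewrite -!(raddf_sum psi) => /in_qpoly_Xn_coef.
rewrite !coef_sum.
under [X in X = _ -> _]eq_bigr => k _ do [rewrite coef_sum; under eq_bigr => m _ do rewrite coef_XnC].
under [X in _ = X -> _]eq_bigr => b _ do rewrite coef_XnC -energyE.
move=> E; etransitivity; first exact: E.
apply: eq_bigr => b _.
have E0 : (fun i => 0 + word_wt b i + staircase i) = (fun i => word_wt b i + staircase i).
  by apply: funext => i; rewrite add0r.
by rewrite E0.
Qed.

(** An increasing permutation satisfies i <= s i, and so does its inverse. *)
Lemma mono_perm_id n (s : 'S_n) : (forall i j : 'I_n, (i < j)%N -> (s i < s j)%N) -> s = 1%g.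
Proof.
have le (u : 'S_n) : (forall i j : 'I_n, (i < j)%N -> (u i < u j)%N) -> forall i : 'I_n, (i <= u i)%N.
  move=> um [i]; elim: i => [|i IH] iN //.
  have iN' := ltnW iN; apply: leq_ltn_trans (IH iN') _.
  exact: um.
move=> sm; apply/permP => i; rewrite perm1; apply/val_inj/eqP; rewrite /= eqn_leq le // andbT.
have vm (a b : 'I_n) : (a < b)%N -> ((s^-1)%g a < (s^-1)%g b)%N.
  move=> ab; case: (ltngtP ((s^-1)%g a) ((s^-1)%g b)) => // [h|h].
    by have := sm _ _ h; rewrite !permKV; lia.
  by move/val_inj/perm_inj: h ab => ->; rewrite ltnn.
by have := le _ vm (s i); rewrite permK.
Qed.

Section CoefficientComparison.
Variables (n : nat) (lam : 'I_n -> nat).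

Let A : comNzRingType := {mpoly int[n]}.
Let x (i : 'I_n) : A := 'X_i.
Let top (i : 'I_n) : nat := (lam i + (n - i.+1))%N.

Lemma mcoeff_alternant (m : 'I_n -> int) :
  mcoeff [multinom top i | i < n] (alternant x m) =
  \sum_(s : 'S_n) (-1) ^+ s * ([forall i, m i == (top (s i))%:Z])%:R.
Proof.
rewrite /alternant /determinant raddf_sum; apply: eq_bigr => s _ /=.
under eq_bigr => i _ do rewrite mxE.
rewrite !mulr_sign.
suff E : (\prod_i hz (geo (x (s i))) (m i))@_[multinom top i | i < n] =
    ([forall i, m i == (top (s i))%:Z])%:R.
  by case: ifP => _; rewrite ?mcoeffN E.
case: (boolP [forall i, 0 <= m i]) => [/forallP m0|/forallPn [i]]; last first.
  rewrite -ltNge => mi; rewrite (bigD1 i) //= hz_neg // mul0r mcoeff0.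
  case: forallP => // /(_ i) /eqP h; lia.
transitivity (('X_[[multinom `|m (s^-1 i)%g|%N | i < n]] : A)@_[multinom top i | i < n]).
  congr (mcoeff _ _); rewrite (mpolyXE _ s); apply: eq_bigr => i _.
  by rewrite mnmE permK; case: (m i) (m0 i) => e.
rewrite mcoeffX; congr (nat_of_bool _)%:R; apply/eqP/forallP => [/mnmP E i|E].
  by have := E (s i); rewrite !mnmE permK => <-; apply/eqP; have := m0 i; lia.
by apply/mnmP => i; rewrite !mnmE; have /eqP := E (s^-1 i)%g; rewrite permKV => ->.
Qed.

Hypothesis lam_dec : forall i j : 'I_n, (i <= j)%N -> (lam j <= lam i)%N.

(** Both mu and lambda become strictly decreasing once the staircase is added, so only the identity
    permutation can match them. *)
Lemma mcoeff_alternant_partition (mu : 'I_n -> int) : is_partition_vec mu ->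
  mcoeff [multinom top i | i < n] (alternant x (fun i => mu i + staircase i)) =
  ([forall i, mu i == (lam i)%:Z])%:R.
Proof.
move=> /partition_vecP [_ dec]; rewrite mcoeff_alternant.
rewrite (bigD1 1%g) //= odd_perm1 expr0 mul1r big1 ?addr0 => [|s s1].
  congr (nat_of_bool _)%:R; apply: eq_forallb => i; rewrite perm1 /top /staircase PoszD.
  by rewrite (inj_eq (addIr _)).
case: forallP => [E|]; last by rewrite mulr0.
case/eqP: s1; apply: mono_perm_id => i j ij.
have /eqP := E i; have /eqP := E j; have := dec i j (ltnW ij).
case: (ltnP (s i) (s j)) => // sji; have := lam_dec sji.
by rewrite /top /staircase; have := ltn_ord (s i); have := ltn_ord (s j); have := ltn_ord i; have := ltn_ord j; lia.
Qed.

(** The alternating sum over permutations is the Leibniz expansion of the alternant; rho exceeds the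
    staircase by 1 in every coordinate, and this shift cancels. *)
Lemma ucoef_alternant d : ucoef lam (fun=> 1%N) d =
  \sum_(k : {ffun posp n -> 'I_d.+1}) \sum_(m : {ffun posp n -> 'I_d.+1})
    (if (\sum_p (k p + m p))%N == d then
       mcoeff [multinom top i | i < n] (alternant x (fun i => 1 + mon_wt k m i + staircase i)) else 0).
Proof.
rewrite pair_bigA /=.
under [RHS]eq_bigr => km _ do rewrite mcoeff_alternant.
rewrite -big_mkcond exchange_big /= (reindex_inj (@invg_inj _)) /=.
apply: eq_bigr => s _; rewrite -mulr_sumr sign_inversions odd_permV; congr (_ * _).
rewrite /fcoef -[Posz _]natz -sum1_card natr_sum big_mkcond [RHS]big_mkcond /=.
apply: eq_bigr => km _; rewrite inE; case: eqP => //= _.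
rewrite (@eq_forallb _ _ (fun i => 1 + mon_wt km.1 km.2 i + staircase i == (top (s^-1%g i))%:Z)).
  by case: ifP.
move=> t; rewrite /rho /staircase /top.
move: (s^-1%g t) (mon_wt km.1 km.2 t) => u w.
by have := ltn_ord t; have := ltn_ord u; move: (lam u) => a un tn; apply/eqP/eqP; lia.
Qed.

(** An unbarred letter adds 1 to the total weight and a barred one subtracts 1. *)
Lemma word_bars (b : {ffun 'I_n -> 'I_(n + n)}) : (forall t, word_wt b t = (lam t)%:Z) ->
  ((n - \sum_i lam i)./2 = \sum_i (n <= b i))%N.
Proof.
move=> bl.
have letter_sum a : \sum_(t < n) letter_wt a t = 1 - (n <= a)%N%:Z *+ 2.
  have n_gt a' (a'n : (a' < n)%N) : \sum_(t < n) (t == a' :> nat)%:Z = 1.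
    rewrite (bigD1 (Ordinal a'n)) //= eqxx big1 ?addr0 // => t.
    by rewrite -val_eqE /= => /negPf ->.
  case: (ltnP a n) => an.
    by under eq_bigr => t _ do rewrite letter_wt_unbarred //; rewrite n_gt.
  under eq_bigr => t _ do rewrite letter_wt_barred //.
  by rewrite sumrN n_gt //; have := ltn_ord a; lia.
have : (\sum_i lam i)%N%:Z = n%:Z - (\sum_i (n <= b i : nat))%N%:Z *+ 2.
  rewrite (big_morph Posz PoszD (erefl _)).
  under eq_bigr => t _ do rewrite -bl.
  rewrite exchange_big /=; under eq_bigr => j _ do rewrite letter_sum.
  rewrite sumrB sumr_const card_ord (big_morph Posz PoszD (erefl _)) sumrMnl.
  by rewrite -[1 *+ n]/(n%:R) natz.
lia.
Qed.

Lemma in_E_word (b : {ffun 'I_n -> 'I_(n + n)}) :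
  in_E lam b = word_ok (fun=> 0) b && [forall t, word_wt b t == (lam t)%:Z].
Proof.
congr (_ && _); apply: eq_forallb => i; congr is_partition_vec.
by apply: funext => t; rewrite add0r.
Qed.

Lemma word_ok_end (b : {ffun 'I_n -> 'I_(n + n)}) :
  word_ok (fun=> 0) b -> is_partition_vec (word_wt b).
Proof.
case: (posnP n) => [n0|n0] /forallP ok.
  by apply/partition_vecP; split=> [i|i]; have := leq_ltn_trans (leq0n i) (ltn_ord i); lia.
have nP : (n.-1 < n)%N by rewrite ltn_predL.
have := ok (Ordinal nP); congr is_true; congr is_partition_vec; apply: funext => t.
rewrite add0r; apply: eq_bigl => j /=; have := ltn_ord j; lia.
Qed.

(** Taking the coefficient of x^(lambda + staircase) in [raising_alternant_eq] keeps exactly the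
    words of weight lambda, which all have the same number of bars. *)
Lemma ucoef_Xpoly d : ucoef lam (fun=> 1%N) d =
  ('X^((n - \sum_(i : 'I_n) lam i)./2) * Xpoly lam)`_d.
Proof.
rewrite ucoef_alternant.
pose cf := mcoeff [multinom top i | i < n] : A -> int.
transitivity (cf (\sum_(k : {ffun posp n -> 'I_d.+1}) \sum_(m : {ffun posp n -> 'I_d.+1})
    (if (\sum_p (k p + m p))%N == d then
       alternant x (fun i => 1 + mon_wt k m i + staircase i) else 0))).
  rewrite /cf raddf_sum; apply: eq_bigr => k _; rewrite raddf_sum; apply: eq_bigr => m _.
  by case: ifP => // _; rewrite raddf0.
rewrite raising_alternant_eq /cf raddf_sum /Xpoly mulr_sumr coef_sum.
rewrite [RHS](eq_bigl _ _ in_E_word) [RHS]big_mkcondr; apply: eq_bigr => b ok /=.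
rewrite -exprD coefXn.
case: (boolP [forall t, _]) => [/forallP bl|nbl].
  rewrite (@word_bars b) => [|t]; last exact/eqP.
  rewrite addnC eq_sym; case: ifP => _; last by rewrite raddf0.
  rewrite mcoeff_alternant_partition ?word_ok_end //.
  by have -> : [forall i, word_wt b i == (lam i)%:Z] by apply/forallP.
case: ifP => _; last by rewrite raddf0.
by rewrite mcoeff_alternant_partition ?word_ok_end // (negPf nbl).
Qed.
End CoefficientComparison.

Theorem mainTheorem9 (n : nat) (lam : 'I_n -> nat) :
  (0 < n)%N ->
  (forall i j : 'I_n, (i <= j)%N -> (lam j <= lam i)%N) ->
  forall d : nat,
    ucoef lam (fun _ => 1%N) d
    = ('X^((n - \sum_(i : 'I_n) lam i)./2) * Xpoly lam)`_d.
Proof. by move=> _ lam_dec d; apply: ucoef_Xpoly. Qed.
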